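(* For every $k\ge2$ and $j\ge0$: $\nu(Z_{2^k,j}(d_{2^k,j}))=0$; $$\nu(Z_{2^k,j}(d_{2^k,j}+1))\ \begin{cases}=1,& j\equiv 2\pmod 4,\\ \ge 2,& j\not\equiv 2\pmod 4;\end{cases}$$ and for every $M\ge2$, $\nu(Z_{2^k,j}(d_{2^k,j}+M))\ge M+1$.
   Context: Let $E(q)=\prod_{m\ge1}(1-q^m)$. Define $$\gamma(q)=\frac{E(q)^5E(q^2)^5E(q^6)^5}{E(q^3)^{15}},\quad \xi=\xi(q)=\frac{E(q^2)^5E(q^6)}{E(q)E(q^3)^5},\quad \kappa(q)=\frac{\gamma(q^2)^2}{\gamma(q)},$$ and let $U\left(\sum_n a_nq^n\right)=\sum_n a_{2n}q^n$. For $i,j\ge0$, $\zeta_{i,j}=U(\kappa^i\xi^j)$, which equals a polynomial in $\xi$ with integer coefficients; write $\zeta_{i,j}=\sum_m Z_{i,j}(m)\xi^m$. Define $d_{i,j}=5I+J$ if $(i,j)=(2I,2J)$; $5I+J+1$ if $(i,j)=(2I,2J+1)$; $5I+J+3$ if $(i,j)=(2I+1,2J)$ or $(2I+1,2J+1)$. $\nu(n)$ is the $2$-adic valuation of an integer $n$, with $\nu(0)=\infty$. *)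

(* Defs.v *)
From mathcomp Require Import all_boot all_algebra.
Set Implicit Arguments. Unset Strict Implicit. Unset Printing Implicit Defensive.
Import GRing.Theory Num.Theory.
Local Open Scope ring_scope.

(* A formal power series sum_n a_n q^n in Z[[q]] is represented by n |-> a_n. *)
Definition series := nat -> int.

Definition s1 : series := fun n => (n == 0)%N%:R.

Definition smul (f g : series) : series :=
  fun n => \sum_(i < n.+1) f i * g (n - i)%N.

Definition spow (f : series) (k : nat) : series := iter k (smul f) s1.

(* Multiplicative inverse of a series with constant term 1:
   1/f = sum_k h^k with h = 1 - f (h has zero constant term, so only
   k <= n contribute to the coefficient of q^n). *)
Definition sinv (f : series) : series :=
  fun n => \sum_(k < n.+1) spow (fun m => s1 m - f m) k n.

Definition sdil (a : nat) (f : series) : series :=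
  fun n => if (a %| n)%N then f (n %/ a)%N else 0.

Definition U2 (f : series) : series := fun n => f (2 * n)%N.

(* E(q) = prod_{m>=1} (1 - q^m): the coefficient of q^n equals the coefficient
   of q^n in the finite product prod_{m=1}^{n} (1 - q^m). *)
Definition Eser : series :=
  fun n => (\prod_(1 <= m < n.+1) (1 - 'X^m : {poly int}))`_n.

Definition Ea (a : nat) : series := sdil a Eser.

Definition gamma : series :=
  smul (smul (spow (Ea 1) 5) (spow (Ea 2) 5))
       (smul (spow (Ea 6) 5) (sinv (spow (Ea 3) 15))).

Definition xi : series :=
  smul (smul (spow (Ea 2) 5) (Ea 6)) (sinv (smul (Ea 1) (spow (Ea 3) 5))).

Definition kappa : series := smul (spow (sdil 2 gamma) 2) (sinv gamma).

Definition zeta (i j : nat) : series := U2 (smul (spow kappa i) (spow xi j)).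

Definition peval (P : {poly int}) (x : series) : series :=
  fun n => \sum_(m < size P) P`_m * spow x m n.

Definition dd (i j : nat) : nat :=
  let I := i./2 in let J := j./2 in
  if ~~ odd i then (if ~~ odd j then 5 * I + J else 5 * I + J + 1)%N
  else (5 * I + J + 3)%N.

(* 2-adic valuation nu, with nu(0) = infinity:
   nu_eq a n  <=>  nu(a) = n ;   nu_ge a n  <=>  nu(a) >= n. *)
Definition nu_eq (a : int) (n : nat) : bool := (a != 0) && (logn 2 `|a|%N == n).
Definition nu_ge (a : int) (n : nat) : bool := (a == 0) || (n <= logn 2 `|a|%N)%N.

(* Main.v *)
Require Import Defs.
From HB Require Import structures.
From mathcomp Require Import all_boot all_algebra.
From mathcomp Require Import boolp.
From mathcomp Require Import ring lra zify.
Set Implicit Arguments. Unset Strict Implicit. Unset Printing Implicit Defensive.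
Import GRing.Theory Num.Theory.
Local Open Scope ring_scope.

(**
Write [E a] for E(q^a).  The functions lambda = E2 E3^3 E4^2 E12^2 / (E1 E6^7),
for which kappa = lambda^5, b = lambda(-q) and x = xi(q^2) satisfy
   lambda b = x,   lambda + b = 2 x,   xi = 3 b - 2 b^2.
Since 2 zeta_{i,j}(q^2) is the sum of kappa^i xi^j and of its image under
q -> -q, it equals
   lambda^(5 i) (3 b - 2 b^2)^j + b^(5 i) (3 lambda - 2 lambda^2)^j,
a symmetric polynomial in the two roots of T^2 - 2 x T + x, hence a polynomial
in x.  Expanding (3 - 2 b)^j, its coefficients are combinations of those of the
Chebyshev-like polynomials (lambda^n + b^n) / 2, whose coefficient s steps above
the lowest one is divisible by 2^(2 s - 1), and by 2^(2 s) for n odd.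

The relations between lambda, b and xi come from two identities of level 6.
The Jacobi triple product gives the 3-dissections of psi(q) = E2^2 / E1 and of
phi(-q) = E1^2 / E2 as eta quotients; taking the norm from Z[[q]] to Z[[q^3]]
yields
   E2^8 E3^4 E6 = E1 E2^3 E3^9 + q E1^4 E6^9,
   E1^8 E3 E6^4 = E2^4 E3^9 - 8 q E1^3 E2 E6^9.
Together with their images under q -> -q and q -> q^2 these determine
lambda + lambda(-q): it is a root of a cubic equation of which only one root is
compatible with the constant terms.
*)

(** * Formal power series *)

(** The wrapper gives series a ring structure with the Cauchy product, apart from any pointwise
    product of functions. *)
Record fps := FPS { coef : series }.

Lemma fpsP (f g : fps) : (forall n, coef f n = coef g n) -> f = g.
Proof. by case: f g => f [g] /= fg; congr FPS; apply: funext. Qed.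

HB.instance Definition _ := gen_eqMixin fps.
HB.instance Definition _ := gen_choiceMixin fps.

Definition fps_zero := FPS (fun _ => 0).
Definition fps_opp f := FPS (fun n => - coef f n).
Definition fps_add f g := FPS (fun n => coef f n + coef g n).
Definition fps_mul f g := FPS (smul (coef f) (coef g)).

Fact fps_addA : associative fps_add.
Proof. by move=> f g h; apply: fpsP => n; apply: addrA. Qed.
Fact fps_addC : commutative fps_add.
Proof. by move=> f g; apply: fpsP => n; apply: addrC. Qed.
Fact fps_add0 : left_id fps_zero fps_add.
Proof. by move=> f; apply: fpsP => n; apply: add0r. Qed.
Fact fps_addN : left_inverse fps_zero fps_opp fps_add.
Proof. by move=> f; apply: fpsP => n; apply: addNr. Qed.

HB.instance Definition _ :=
  GRing.isZmodule.Build fps fps_addA fps_addC fps_add0 fps_addN.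

Definition trunc n (f : series) : {poly int} := \poly_(i < n.+1) f i.

(** Coefficient n of a Cauchy product involves only coefficients up to n, so ring laws can be read
    off polynomials that agree with the series up to degree n. *)
Lemma smul_poly n (f g : series) (P Q : {poly int}) :
    (forall i, (i <= n)%N -> P`_i = f i) -> (forall i, (i <= n)%N -> Q`_i = g i) ->
  smul f g n = (P * Q)`_n.
Proof.
move=> Pf Qg; rewrite coefM; apply: eq_bigr => i _.
by rewrite Pf ?Qg ?leq_subr // -ltnS.
Qed.

Lemma coef_trunc n f i : (i <= n)%N -> (trunc n f)`_i = f i.
Proof. by rewrite coef_poly ltnS => ->. Qed.

Fact fps_mulA : associative fps_mul.
Proof.
move=> f g h; apply: fpsP => n /=.
pose T k := @coef_trunc n (coef k).
have mulT k l i : (i <= n)%N -> (trunc n (coef k) * trunc n (coef l))`_i = smul (coef k) (coef l) i.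
  move=> le_in; rewrite (@smul_poly i _ _ (trunc n (coef k)) (trunc n (coef l))) // => m le_mi.
    by rewrite T // (leq_trans le_mi).
  by rewrite T // (leq_trans le_mi).
by rewrite (smul_poly (T f) (mulT g h)) (smul_poly (mulT f g) (T h)) mulrA.
Qed.

Fact fps_mulC : commutative fps_mul.
Proof.
move=> f g; apply: fpsP => n /=.
rewrite (smul_poly (@coef_trunc n (coef f)) (@coef_trunc n (coef g))) mulrC.
by rewrite -(smul_poly (@coef_trunc n (coef g)) (@coef_trunc n (coef f))).
Qed.

Fact fps_mul1 : left_id (FPS s1) fps_mul.
Proof.
move=> f; apply: fpsP => n /=.
by rewrite /smul big_ord_recl big1 => [|i _]; rewrite /s1 /= ?mul0r // mul1r subn0 addr0.
Qed.

Fact fps_mulDl : left_distributive fps_mul fps_add.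
Proof.
move=> f g h; apply: fpsP => n /=; rewrite /smul -big_split /=.
by apply: eq_bigr => i _; rewrite mulrDl.
Qed.

Fact fps_oner_neq0 : FPS s1 != 0.
Proof. by apply/eqP => /(congr1 (fun f => coef f 0)). Qed.

HB.instance Definition _ :=
  GRing.Zmodule_isComNzRing.Build fps fps_mulA fps_mulC fps_mul1 fps_mulDl fps_oner_neq0.

(** Invertibility is existential and the inverse is picked by choice; uniqueness of inverses later
    identifies it with [sinv]. *)
Definition fps_unit : pred fps := fun f => `[< exists g : fps, g * f = 1 >].
Definition fps_inv (f : fps) : fps :=
  if pselect (exists g : fps, g * f = 1) is left ex then projT1 (cid ex) else f.

Fact fps_mulV : {in fps_unit, left_inverse 1 fps_inv *%R}.
Proof.
move=> f /asboolP exg; rewrite /fps_inv; case: pselect => // ex.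
exact: projT2 (cid ex).
Qed.

Fact fps_unitP (f g : fps) : g * f = 1 -> fps_unit f.
Proof. by move=> gf1; apply/asboolP; exists g. Qed.

Fact fps_inv_out : {in [predC fps_unit], fps_inv =1 id}.
Proof.
move=> f; rewrite inE /= => /asboolP not_ex; rewrite /fps_inv.
by case: pselect => // /not_ex.
Qed.

HB.instance Definition _ :=
  GRing.ComNzRing_hasMulInverse.Build fps fps_mulV fps_unitP fps_inv_out.

Lemma coefM_fps (f g : fps) n : coef (f * g) n = \sum_(i < n.+1) coef f i * coef g (n - i)%N.
Proof. by []. Qed.

(** If m and n are the orders of f and g, coefficient m + n of the product is the product of the two
    lowest coefficients. *)
Fact fps_idomain (f g : fps) : f * g = 0 -> (f == 0) || (g == 0).
Proof.
have low (h : fps) : h != 0 -> exists2 m, coef h m != 0 & forall i, (i < m)%N -> coef h i = 0.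
  move=> h0; have exh : exists m, coef h m != 0.
    apply: contrapT => nex; move/eqP: h0; apply; apply: fpsP => m.
    by apply/eqP; apply: contrapT => hm; apply: nex; exists m; apply/negP.
  exists (ex_minn exh); first by case: ex_minnP.
  move=> i; case: ex_minnP => m _ min_m; apply: contraTeq => /min_m.
  by rewrite -leqNgt.
move=> fg0; apply: contrapT => /negP; rewrite negb_or => /andP[/low[m fm f_lt] /low[n gn g_lt]].
have := congr1 (fun h => coef h (m + n)%N) fg0; rewrite coefM_fps /=.
have lt_m : (m < (m + n).+1)%N by rewrite ltnS leq_addr.
rewrite (bigD1 (Ordinal lt_m)) //= addKn big1 ?addr0.
  by apply/eqP; rewrite mulf_neq0.
move=> i; rewrite -val_eqE /= => ne_im; have [lt_im|] := ltnP i m; first by rewrite f_lt ?mul0r.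
rewrite leq_eqVlt eq_sym (negPf ne_im) /= => lt_mi.
by rewrite g_lt ?mulr0 //; have := ltn_ord i; lia.
Qed.

HB.instance Definition _ := GRing.ComUnitRing_isIntegral.Build fps fps_idomain.

Section CoefAdd.
Variable n : nat.
Definition coefn (f : fps) : int := coef f n.
Fact coefn_zmod : zmod_morphism coefn. Proof. by []. Qed.
HB.instance Definition _ := GRing.isZmodMorphism.Build fps int coefn coefn_zmod.
End CoefAdd.

Definition q : fps := FPS (fun n => (n == 1)%N%:R).

Lemma coef_fps1 n : coef 1 n = (n == 0)%N%:R. Proof. by []. Qed.

Lemma coef_qM (f : fps) n : coef (q * f) n = if n is m.+1 then coef f m else 0.
Proof.
case: n => [|n]; first by rewrite coefM_fps big_ord1 mul0r.
rewrite coefM_fps !big_ord_recl /= mul0r add0r mul1r subSS subn0 big1 ?addr0 // => i _.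
by rewrite mul0r.
Qed.

Lemma coef_qnM k (f : fps) n : coef (q ^+ k * f) n = if (k <= n)%N then coef f (n - k)%N else 0.
Proof.
elim: k n => [|k IH] n; first by rewrite mul1r subn0.
by rewrite exprS -mulrA coef_qM; case: n => // n; rewrite IH.
Qed.

Lemma coef_qn k n : coef (q ^+ k) n = (n == k)%:R.
Proof. by rewrite -[q ^+ k]mulr1 coef_qnM coef_fps1 subn_eq0; case: ltngtP. Qed.

Definition c0 (f : fps) : int := coef f 0.
Arguments c0 : simpl never.
Fact c0_zmod : zmod_morphism c0. Proof. by []. Qed.
Fact c0_mul : monoid_morphism c0.
Proof. by split=> // f g; rewrite /c0 coefM_fps big_ord1. Qed.
HB.instance Definition _ := GRing.isZmodMorphism.Build fps int c0 c0_zmod.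
HB.instance Definition _ := GRing.isMonoidMorphism.Build fps int c0 c0_mul.

(** Congruence modulo q^N, which plays the role of the q-adic topology in the limit arguments. *)
Definition eqm N (f g : fps) := forall n, (n < N)%N -> coef f n = coef g n.

Lemma eqm_refl N f : eqm N f f. Proof. by []. Qed.
Lemma eqm_sym N f g : eqm N f g -> eqm N g f. Proof. by move=> fg n ltn; rewrite fg. Qed.
Lemma eqm_trans N f g h : eqm N f g -> eqm N g h -> eqm N f h.
Proof. by move=> fg gh n ltn; rewrite fg ?gh. Qed.
Lemma eqmW M N f g : (M <= N)%N -> eqm N f g -> eqm M f g.
Proof. by move=> le_MN fg n ltn; rewrite fg // (leq_trans ltn). Qed.
Lemma eqmP f g : (forall N, eqm N f g) -> f = g.
Proof. by move=> fg; apply: fpsP => n; apply: (fg n.+1). Qed.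
Lemma eqmM N f f' g g' : eqm N f f' -> eqm N g g' -> eqm N (f * g) (f' * g').
Proof.
move=> ff gg n ltn; rewrite !coefM_fps; apply: eq_bigr => i _.
by rewrite ff ?gg //; have := ltn_ord i; lia.
Qed.
Lemma eqmD N f f' g g' : eqm N f f' -> eqm N g g' -> eqm N (f + g) (f' + g').
Proof. by move=> ff gg n ltn; rewrite /= ff ?gg. Qed.
Lemma eqmN N f f' : eqm N f f' -> eqm N (- f) (- f').
Proof. by move=> ff n ltn; rewrite /= ff. Qed.
Lemma eqm_prod N (I : Type) (r : seq I) (P : pred I) F G :
  (forall i, P i -> eqm N (F i) (G i)) ->
  eqm N (\prod_(i <- r | P i) F i) (\prod_(i <- r | P i) G i).
Proof. by move=> FG; elim/big_ind2: _ => // *; apply: eqmM. Qed.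
Lemma eqm_sum N (I : Type) (r : seq I) (P : pred I) F G :
  (forall i, P i -> eqm N (F i) (G i)) ->
  eqm N (\sum_(i <- r | P i) F i) (\sum_(i <- r | P i) G i).
Proof. by move=> FG; elim/big_ind2: _ => // *; apply: eqmD. Qed.
Lemma eqm_qn N n f : (N <= n)%N -> eqm N (q ^+ n * f) 0.
Proof. by move=> le_Nn m ltm; rewrite coef_qnM leqNgt (leq_trans ltm). Qed.
Lemma eqm0P N f : eqm N f 0 <-> exists g, f = q ^+ N * g.
Proof.
split=> [f0|[g ->]]; last exact: eqm_qn.
exists (FPS (fun n => coef f (n + N)%N)); apply: fpsP => n; rewrite coef_qnM /=.
by case: leqP => [le_Nn|/f0 //]; rewrite subnK.
Qed.
Lemma eqm_subr N f g : eqm N f g <-> eqm N (f - g) 0.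
Proof.
by split=> fg n /fg /=; [move->; rewrite subrr | move/eqP; rewrite subr_eq0 => /eqP].
Qed.

(** With h = 1 - f divisible by q, [sinv] agrees below q^N with the geometric sum of the h^k for k <
    N, and f times that sum is 1 - h^N. *)
Lemma c0_unit (f : fps) : c0 f = 1 -> f * FPS (sinv (coef f)) = 1.
Proof.
move=> f1; set h : fps := 1 - f.
have h_low : exists g, h = q * g.
  have [|g ->] := (@eqm0P 1 h).1; last by exists g.
  by case=> // _; have: c0 (1 - f) = 0 by rewrite rmorphB rmorph1 /= f1.
have spow_h k : spow (fun m => s1 m - coef f m) k = coef (h ^+ k).
  by elim: k => [|k IH] //; rewrite exprS /spow iterS -/(spow _ k) IH.
apply: eqmP => N.
have sinvE : eqm N (FPS (sinv (coef f))) (\sum_(k < N) h ^+ k).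
  move=> n ltn /=; rewrite /sinv -[RHS]/(coefn n (\sum_(k < N) h ^+ k)) raddf_sum.
  rewrite (big_ord_widen _ (fun k => spow (fun m => s1 m - coef f m) k n) ltn).
  rewrite [RHS](bigID (fun i : 'I_N => i < n.+1)%N) /= [X in _ = _ + X]big1 ?addr0.
    by apply: eq_bigr => i _; rewrite spow_h.
  move=> i; rewrite -leqNgt => lt_ni; have [g hg] := h_low.
  by rewrite /coefn hg exprMn coef_qnM leqNgt lt_ni.
apply: eqm_trans (eqmM (@eqm_refl N f) sinvE) _.
have -> : f * (\sum_(k < N) h ^+ k) = 1 - h ^+ N.
  rewrite -opprB subrX1 -mulNr opprB; congr (_ * _).
  by rewrite /h opprB addrC subrK.
have [g ->] := h_low; apply/eqm_subr; rewrite addrAC subrr add0r exprMn.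
by rewrite -mulrN; apply: eqm_qn.
Qed.

(** * Substitutions and infinite products *)

Lemma c0_unitr (f : fps) : c0 f = 1 -> f \is a GRing.unit.
Proof. by move/c0_unit => fV; apply/unitrPr; eexists; exact: fV. Qed.

Lemma c0_neq0 (f : fps) : c0 f = 1 -> f != 0.
Proof. by move=> f1; apply: contra_eq_neq f1 => ->; rewrite rmorph0. Qed.

Lemma eqmX N (f g : fps) k : eqm N f g -> eqm N (f ^+ k) (g ^+ k).
Proof. by move=> fg; elim: k => [//|k IH]; rewrite !exprS; apply: eqmM. Qed.

Lemma eqmM1 N f g : eqm N f 1 -> eqm N g 1 -> eqm N (f * g) 1.
Proof. by move=> f1 g1; rewrite -[1]mulr1; apply: eqmM. Qed.

Lemma eqm_prod1 N (I : Type) (r : seq I) (P : pred I) F :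
  (forall i, P i -> eqm N (F i) 1) -> eqm N (\prod_(i <- r | P i) F i) 1.
Proof. by move=> F1; elim/big_ind: _ => // f g; apply: eqmM1. Qed.

Definition dil a (f : fps) : fps := FPS (sdil a (coef f)).

Fact dil_zmod a : zmod_morphism (dil a.+1).
Proof. by move=> f g; apply: fpsP => n /=; rewrite /sdil; case: ifP => //=; rewrite subr0. Qed.

Fact dil_mul a : monoid_morphism (dil a.+1).
Proof.
split=> [|f g]; apply: fpsP => n /=; rewrite /sdil.
  by case: n => [|n]; rewrite ?div0n // /s1; case: ifP => // /dvdnP[[|k] ->] //; rewrite mulnK.
rewrite /smul; case: ifP => [/dvdnP[m ->{n}]|ndiv].
  rewrite mulnK //; pose F i := sdil a.+1 (coef f) i * sdil a.+1 (coef g) (m * a.+1 - i)%N.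
  (* Only the indices divisible by the dilation factor contribute to the convolution. *)
  have collapse k : (k <= m)%N -> \sum_(i < (k * a.+1).+1) F i = \sum_(i < k.+1) F (i * a.+1)%N.
    elim: k => [|k IH] le_km; first by rewrite !big_ord1.
    rewrite [RHS]big_ord_recr /= -(IH (ltnW le_km)) -!(big_mkord xpredT F).
    rewrite (@big_cat_nat _ _ _ (k * a.+1).+1) //=; last by rewrite mulSn ltnS leq_addl.
    congr (_ + _); rewrite big_nat_recr /=; last by rewrite mulSn -addn1 addnC leq_add2r.
    rewrite big_nat_cond big1 ?add0r // => i /andP[/andP[lo hi] _].
    rewrite /F /sdil; case: ifP => [/dvdnP[l li]|]; last by rewrite mul0r.
    by move: lo hi; rewrite li !ltn_mul2r /= => lo hi; lia.
  rewrite [RHS](collapse m) //; apply: eq_bigr => i _.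
  by rewrite /F /sdil dvdn_mull // mulnK // -mulnBl dvdn_mull // mulnK.
rewrite big1 // => i _; rewrite /sdil; case: ifP => [di|]; last by rewrite mul0r.
case: ifP => [dni|]; last by rewrite mulr0.
have := dvdn_add di dni; rewrite subnKC ?ndiv //.
by rewrite -ltnS.
Qed.

HB.instance Definition _ a := GRing.isZmodMorphism.Build fps fps (dil a.+1) (@dil_zmod a).
HB.instance Definition _ a := GRing.isMonoidMorphism.Build fps fps (dil a.+1) (@dil_mul a).

Lemma dil_qn a n : (0 < a)%N -> dil a (q ^+ n) = q ^+ (a * n).
Proof.
case: a => // a _; apply: fpsP => m; rewrite /= -/(coef _ _) /sdil !coef_qn.
case: ifP => [/dvdnP[k ->]|]; first by rewrite mulnK // mulnC eqn_pmul2l.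
by case: eqP => // ->; rewrite dvdn_mulr.
Qed.

Lemma dil_eqm N a f g : (0 < a)%N -> eqm N f g -> eqm N (dil a f) (dil a g).
Proof.
move=> a0 fg n ltn /=; rewrite /sdil; case: ifP => // _.
by apply: fg; apply: leq_ltn_trans ltn; apply: leq_div.
Qed.

Lemma dil_dil a b f : (0 < a)%N -> (0 < b)%N -> dil a (dil b f) = dil (a * b) f.
Proof.
move=> a0 b0; apply: fpsP => n /=; rewrite /sdil; case: (boolP (a %| n)%N) => [/dvdnP[m ->]|na].
  by rewrite mulnK // [(m * a)%N]mulnC dvdn_pmul2l // divnMl.
by case: ifP => // /dvdnP[k kn]; move: na; rewrite kn mulnCA dvdn_mulr.
Qed.

Lemma c0_dil a f : c0 (dil a f) = c0 f.
Proof. by rewrite /c0 /= /sdil dvdn0 div0n. Qed.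

Lemma dil_inj a : (0 < a)%N -> injective (dil a).
Proof.
move=> a0 f g fg; apply: fpsP => n; have /= := congr1 (fun h => coef h (n * a)%N) fg.
by rewrite /sdil dvdn_mull // mulnK.
Qed.

Definition conj (f : fps) : fps := FPS (fun n => (-1) ^+ n * coef f n).

Fact conj_zmod : zmod_morphism conj.
Proof. by move=> f g; apply: fpsP => n /=; rewrite mulrBr. Qed.

Fact conj_mul : monoid_morphism conj.
Proof.
split=> [|f g]; apply: fpsP => n /=; first by case: n => //= n; rewrite mulr0.
rewrite /smul big_distrr; apply: eq_bigr => i _ /=.
by rewrite mulrACA -exprD subnKC // -ltnS.
Qed.

HB.instance Definition _ := GRing.isZmodMorphism.Build fps fps conj conj_zmod.
HB.instance Definition _ := GRing.isMonoidMorphism.Build fps fps conj conj_mul.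

Lemma conj_q : conj q = - q.
Proof. by apply: fpsP => -[|[|n]] //=; rewrite mulr0. Qed.

Lemma conj_eqm N f g : eqm N f g -> eqm N (conj f) (conj g).
Proof. by move=> fg n ltn /=; rewrite fg. Qed.

Lemma c0_conj f : c0 (conj f) = c0 f.
Proof. by rewrite /c0 /= mul1r. Qed.

Lemma conjK : involutive conj.
Proof. by move=> f; apply: fpsP => n /=; rewrite signrMK. Qed.

Lemma conj_dil2 f : conj (dil 2 f) = dil 2 f.
Proof.
apply: fpsP => n /=; rewrite /sdil; case: ifP => [|_]; last by rewrite mulr0.
by rewrite dvdn2 -signr_odd => /negPf->; rewrite mul1r.
Qed.

Lemma conj_dil3 f : conj (dil 3 f) = dil 3 (conj f).
Proof.
apply: fpsP => n /=; rewrite /sdil; case: ifP => [|_]; last by rewrite mulr0.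
by case/dvdnP=> m ->; rewrite mulnK // -signr_odd oddM andbT signr_odd.
Qed.

(** Odd coefficients cancel and even ones double; this turns the operator U into symmetrisation
    under q -> -q. *)
Lemma add_conj f : f + conj f = (dil 2 (FPS (U2 (coef f)))) *+ 2.
Proof.
apply: fpsP => n; rewrite -[RHS]/(coefn n _) raddfMn /coefn /= /sdil /U2.
case: ifP => [/dvdnP[m ->]|]; first by rewrite mulnK // mulnC -signr_odd oddM mul1r.
by rewrite dvdn2 -signr_odd => /negbFE->; rewrite mulN1r subrr.
Qed.

Lemma fps_mulrn2_inj (f g : fps) : f *+ 2 = g *+ 2 -> f = g.
Proof.
move=> fg; apply: fpsP => n; have := congr1 (coefn n) fg.
by rewrite !raddfMn /= => /eqP; rewrite eqr_pMn2r // => /eqP.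
Qed.

Definition conv (h : nat -> fps) := forall i, eqm i (h i) 1.
(* Meaningful for [conv h] only: then the factors h i with i > n do not affect q^n. *)
Definition iprod (h : nat -> fps) := FPS (fun n => coef (\prod_(i < n.+1) h i) n).

Lemma prod_eqm h M n n' : (forall i, eqm M (h (n + i)%N) 1) -> (n <= n')%N ->
  eqm M (\prod_(i < n') h i) (\prod_(i < n) h i).
Proof.
move=> h1 le_nn'; rewrite -(subnKC le_nn'); elim: (n' - n)%N => [|d IH].
  by rewrite addn0.
by rewrite addnS big_ord_recr /= -[X in eqm _ _ X]mulr1; apply: eqmM.
Qed.

Lemma iprodE h M n : conv h -> (M <= n)%N -> eqm M (iprod h) (\prod_(i < n) h i).
Proof.
move=> ch le_Mn m ltm /=; apply/esym/(@prod_eqm h m.+1) => // [i|].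
  by apply: eqmW (ch _); rewrite addSn ltnS leq_addr.
by rewrite (leq_trans ltm).
Qed.

(** Uniqueness of q-adic limits; identities between infinite products thereby reduce to finite
    partial products. *)
Lemma iprod_lim h f : conv h ->
  (forall M, exists2 n, (M <= n)%N & eqm M f (\prod_(i < n) h i)) -> f = iprod h.
Proof.
move=> ch fh; apply: eqmP => M; have [n le_Mn fn] := fh M.
exact: eqm_trans fn (eqm_sym (iprodE ch le_Mn)).
Qed.

Lemma eq_iprod h h' : h =1 h' -> iprod h = iprod h'.
Proof. by move=> hh; apply: fpsP => n /=; congr coef; apply: eq_bigr => i _. Qed.

Lemma convM h h' : conv h -> conv h' -> conv (fun i => h i * h' i).
Proof. by move=> ch ch' i; apply: eqmM1. Qed.

Lemma iprodM h h' : conv h -> conv h' -> iprod (fun i => h i * h' i) = iprod h * iprod h'.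
Proof.
move=> ch ch'; apply/esym/iprod_lim; first exact: convM.
by move=> M; exists M => //; rewrite big_split; apply: eqmM; apply: iprodE.
Qed.

Lemma conv_prod d (h : 'I_d -> nat -> fps) :
  (forall j, conv (h j)) -> conv (fun i => \prod_(j < d) h j i).
Proof. by move=> ch i; apply: eqm_prod1 => j _; apply: ch. Qed.

Lemma iprod_prod d (h : 'I_d -> nat -> fps) : (forall j, conv (h j)) ->
  iprod (fun i => \prod_(j < d) h j i) = \prod_(j < d) iprod (h j).
Proof.
move=> ch; apply/esym/iprod_lim; first exact: conv_prod.
move=> M; exists M => //; rewrite exchange_big.
by apply: eqm_prod => j _; apply: iprodE.
Qed.

Lemma conv_regroup d (h : nat -> fps) : (0 < d)%N -> conv h -> conv (fun i => \prod_(j < d) h (d * i + j)%N).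
Proof.
move=> d0 ch i; apply: eqm_prod1 => j _; apply: eqmW (ch _).
by rewrite (leq_trans (leq_pmull i d0)) ?leq_addr.
Qed.

Lemma prod_regroup d (h : nat -> fps) n :
  \prod_(i < d * n) h i = \prod_(i < n) \prod_(j < d) h (d * i + j)%N :> fps.
Proof.
elim: n => [|n IH]; first by rewrite muln0 !big_ord0.
by rewrite big_ord_recr -IH /= mulnSr big_split_ord.
Qed.

Lemma iprod_regroup d h : (0 < d)%N -> conv h ->
  iprod h = iprod (fun i => \prod_(j < d) h (d * i + j)%N).
Proof.
move=> d0 ch; apply: iprod_lim; first exact: conv_regroup.
move=> M; exists M => //; rewrite -prod_regroup; apply: iprodE => //.
exact: leq_pmull.
Qed.

(** F is taken multiplicative and q-adically continuous rather than a ring morphism, so that the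
    statement also covers [norm3]. *)
Lemma iprod_map (F : fps -> fps) h : conv h -> conv (fun i => F (h i)) ->
  F 1 = 1 -> {morph F : f g / f * g} ->
  (forall M, exists N, forall f g, eqm N f g -> eqm M (F f) (F g)) ->
  F (iprod h) = iprod (fun i => F (h i)).
Proof.
move=> ch cFh F1 FM Fc; apply: iprod_lim => // M; have [N FN] := Fc M.
exists (maxn M N); first exact: leq_maxl.
rewrite -(big_morph F FM F1); apply: FN; apply: iprodE => //; exact: leq_maxr.
Qed.

(* W m r = (q^r; q^m)_oo, and below V m r = (-q^r; q^m)_oo *)
Definition W m r := iprod (fun i => 1 - q ^+ (r + m * i)).

Lemma conv1q (s : fps) (e : nat -> nat) : (forall i, i <= e i)%N -> conv (fun i => 1 + s * q ^+ (e i)).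
Proof.
move=> le_e i; apply/eqm_subr; rewrite addrAC subrr add0r mulrC.
by apply: eqm_qn.
Qed.

Lemma le_lin m r i : (0 < m)%N -> (i <= r + m * i)%N.
Proof. by move=> m0; rewrite (leq_trans (leq_pmull i m0)) ?leq_addl. Qed.

Lemma conv_lin s m r : (0 < m)%N -> conv (fun i => 1 + s * q ^+ (r + m * i)).
Proof. by move=> m0; apply: conv1q => i; apply: le_lin. Qed.

Lemma conv_W m r : (0 < m)%N -> conv (fun i => 1 - q ^+ (r + m * i)).
Proof. by move=> m0 i; rewrite -mulN1r; apply: (@conv_lin (-1)). Qed.

(** Sorts the factors by the residue of their index modulo d. *)
Lemma W_split d m r : (0 < m)%N -> (0 < d)%N -> W m r = \prod_(j < d) W (m * d) (r + m * j).
Proof.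
move=> m0 d0; rewrite /W (iprod_regroup d0 (conv_W _ m0)) -iprod_prod; last first.
  by move=> j; apply: conv_W; rewrite muln_gt0 m0.
apply: eq_iprod => i; apply: eq_bigr => j _; congr (1 - q ^+ _).
by rewrite mulnDr mulnA addnAC addnA.
Qed.

Lemma c0_W m r : (0 < r)%N -> c0 (W m r) = 1.
Proof.
move=> r0; rewrite /c0 /= big_ord1 /= muln0 addn0 coef_qn eq_sym.
by case: r r0 => // r _; rewrite subr0.
Qed.

Lemma dil_W a m r : (0 < a)%N -> (0 < m)%N -> dil a (W m r) = W (a * m) (a * r).
Proof.
case: a => // a _ m0; have F i : dil a.+1 (1 - q ^+ (r + m * i)) = 1 - q ^+ (a.+1 * r + a.+1 * m * i).
  by rewrite rmorphB rmorph1 /= dil_qn // mulnDr mulnA.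
rewrite /W (iprod_map (F := dil a.+1)); first exact: eq_iprod.
- exact: conv_W.
- by move=> i; rewrite F; apply: conv_W; rewrite muln_gt0 m0.
- exact: rmorph1.
- exact: rmorphM.
- by move=> M; exists M => f g; apply: dil_eqm.
Qed.

Definition V m r := iprod (fun i => 1 + q ^+ (r + m * i)).

Lemma conv_V m r : (0 < m)%N -> conv (fun i => 1 + q ^+ (r + m * i)).
Proof. by move=> m0 i; rewrite -[q ^+ _]mul1r; apply: (@conv_lin 1). Qed.

Lemma VW m r : (0 < m)%N -> V m r * W m r = W (2 * m) (2 * r).
Proof.
move=> m0; rewrite -iprodM; [|exact: conv_V|exact: conv_W].
apply: eq_iprod => i; rewrite mulrC -subr_sqr expr1n -exprM mulnDl.
by rewrite ![(_ * 2)%N]mulnC mulnA.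
Qed.

Definition fps_of_poly (P : {poly int}) : fps := FPS (fun n => P`_n).
Fact fps_of_poly_zmod : zmod_morphism fps_of_poly.
Proof. by move=> P Q; apply: fpsP => n /=; rewrite coefB. Qed.
Fact fps_of_poly_mul : monoid_morphism fps_of_poly.
Proof.
split=> [|P Q]; apply: fpsP => n /=; first by rewrite coefC; case: n.
by rewrite coefM.
Qed.
HB.instance Definition _ := GRing.isZmodMorphism.Build _ _ fps_of_poly fps_of_poly_zmod.
HB.instance Definition _ := GRing.isMonoidMorphism.Build _ _ fps_of_poly fps_of_poly_mul.

Lemma Eser_W : FPS Eser = W 1 1.
Proof.
have P i : fps_of_poly (1 - 'X^(i.+1)) = 1 - q ^+ (1 + 1 * i).
  rewrite rmorphB rmorph1 mul1n; congr (_ - _); apply: fpsP => m.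
  by rewrite coef_qn /= coefXn.
apply: fpsP => n.
have -> : coef (FPS Eser) n = coef (\prod_(i < n) (1 - q ^+ (1 + 1 * i))) n.
  rewrite /= /Eser -[LHS]/(coef (fps_of_poly _) n) rmorph_prod big_add1 big_mkord /=.
  by under eq_bigr do rewrite P.
apply: esym; apply: (@prod_eqm (fun i => 1 - q ^+ (1 + 1 * i)) n.+1 n n.+1 _ _ n) => // i.
apply/eqm_subr; rewrite addrAC subrr add0r -mulrN1; apply: eqm_qn.
by rewrite mul1n ltnS leq_addr.
Qed.

Lemma Ea_W a : (0 < a)%N -> FPS (Ea a) = W a a.
Proof. by move=> a0; rewrite -[FPS _]/(dil a (FPS Eser)) Eser_W dil_W // muln1. Qed.

(** * Theta functions and the triple product *)

Section QBinomial.
Variables (R : comNzRingType) (Q : R).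

(** Gaussian binomial coefficients, given by the q-Pascal rule so that they make sense in any
    commutative ring, without division. *)
Fixpoint qbin n k : R :=
  match n, k with
  | _, 0 => 1
  | 0, _.+1 => 0
  | n.+1, k.+1 => qbin n k + Q ^+ k.+1 * qbin n k.+1
  end.

Arguments qbin : simpl never.

Definition qfact n : R := \prod_(i < n) (1 - Q ^+ i.+1).

Lemma qbin0 n : qbin n 0 = 1. Proof. by case: n. Qed.
Lemma qbinS n k : qbin n.+1 k.+1 = qbin n k + Q ^+ k.+1 * qbin n k.+1. Proof. by []. Qed.

Lemma qbin_small n k : (n < k)%N -> qbin n k = 0.
Proof.
elim: n k => [|n IH] [|k] //; rewrite ltnS => lt_nk.
by rewrite qbinS !IH ?mulr0 ?addr0 // ltnW.
Qed.

Lemma qfactS n : qfact n.+1 = qfact n * (1 - Q ^+ n.+1).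
Proof. by rewrite /qfact big_ord_recr. Qed.

(** Induction on m + k through the q-Pascal rule; the two contributions add up because 1 - Q^(m+k) =
    (1 - Q^k) + Q^k (1 - Q^m). *)
Lemma qbin_fact m k : qbin (m + k) k * (qfact k * qfact m) = qfact (m + k).
Proof.
have [n] := ubnP (m + k); elim: n m k => // n IH m [|k] lt_mkn.
  by rewrite addn0 qbin0 /qfact big_ord0 !mul1r.
case: m lt_mkn => [|m] lt_mkn.
  have := IH 0%N k; rewrite !add0n => IH0; rewrite qbinS (qbin_small (ltnSn k)) mulr0 addr0.
  by rewrite !qfactS -[X in _ = X * _]IH0 // /qfact [\prod_(i < 0) _]big_ord0; ring.
rewrite addnS qbinS mulrDl.
have lt1 : (m.+1 + k < n)%N by rewrite -ltnS -addnS.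
have lt2 : (m + k.+1 < n)%N by rewrite addnS -addSn.
have IH1 := IH _ _ lt1; have IH2 := IH _ _ lt2.
transitivity ((1 - Q ^+ k.+1) * (qbin (m.+1 + k) k * (qfact k * qfact m.+1)) +
   Q ^+ k.+1 * (1 - Q ^+ m.+1) * (qbin (m + k.+1) k.+1 * (qfact k.+1 * qfact m))).
  by rewrite !qfactS -addSnnS; ring.
rewrite IH1 IH2 qfactS -addSnnS; have -> : (m.+1 + k).+1 = (k.+1 + m.+1)%N by lia.
by rewrite exprD; ring.
Qed.

(** Peeling off the factor w + z leaves the same product with z Q for z, and the terms recombine by
    the q-Pascal rule. The variable w is there for the specialisation w = Q^n in the triple
    product. *)
Lemma qbin_thm (w z : R) n :
  \prod_(i < n) (w + z * Q ^+ i) =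
  \sum_(k < n.+1) Q ^+ 'C(k, 2) * qbin n k * z ^+ k * w ^+ (n - k).
Proof.
elim: n z => [|n IH] z; first by rewrite big_ord0 big_ord1 bin_small //= !mulr1.
rewrite big_ord_recl mulr1.
under eq_bigr => i _ do rewrite lift0 exprS mulrA.
rewrite IH [RHS]big_ord_recl /= qbin0 bin_small // !mulr1 mul1r subn0.
under [X in _ = _ + X]eq_bigr => i _.
  rewrite /bump leq0n add1n subSS qbinS binS bin1 mulrDr !mulrDl.
  over.
rewrite big_split /= [in X in _ = _ + (_ + X)]big_ord_recr /= (qbin_small (ltnSn n)).
rewrite !(mulr0, mul0r) addr0 mulrDl addrC.
have -> : w * \sum_(k < n.+1) Q ^+ 'C(k, 2) * qbin n k * (z * Q) ^+ k * w ^+ (n - k) =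
  w ^+ n.+1 + \sum_(i < n) Q ^+ ('C(i, 2) + i) * (Q ^+ i.+1 * qbin n i.+1) * z ^+ i.+1 * w ^+ (n - i).
  rewrite big_ord_recl /= qbin0 bin_small // !mulr1 mul1r subn0 mulrDr -exprS; congr (_ + _).
  rewrite big_distrr; apply: eq_bigr => i _; rewrite /bump leq0n add1n /= binS bin1.
  by rewrite -(subnSK (ltn_ord i)) [w ^+ _.+1]exprS exprMn; ring.
rewrite addrCA; congr (_ + _); congr (_ + _).
rewrite big_distrr; apply: eq_bigr => i _ /=.
by rewrite exprD exprMn exprS; ring.
Qed.

End QBinomial.

(* k (k + 1) / 2, for k negative as well *)
Definition tri (k : int) : nat := match k with Posz n => 'C(n.+1, 2) | Negz n => 'C(n.+1, 2) end.

Lemma bin2_double n : ('C(n.+1, 2) * 2 = n.+1 * n)%N.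
Proof. by rewrite mulnC -mul_bin_diag bin1. Qed.

Lemma triE k : (tri k)%:Z * 2 = k * (k + 1).
Proof. case: k => n; have := bin2_double n; rewrite /tri; nia. Qed.

Definition bsum n (F : int -> fps) := \sum_(i < n.*2.+1) F (i%:Z - n%:Z).

Lemma bsum0 F : bsum 0 F = F 0.
Proof. by rewrite /bsum big_ord1. Qed.

Lemma bsumS n F : bsum n.+1 F = bsum n F + (F n.+1%:Z + F (- n.+1%:Z)).
Proof.
rewrite /bsum doubleS big_ord_recl big_ord_recr /= [LHS]addrC -[LHS]addrA; congr (_ + _).
  by apply: eq_bigr => i _; congr F; rewrite /bump /=; lia.
by congr (F _ + F _); rewrite /bump /=; lia.
Qed.

Lemma bsumN n F : bsum n F = bsum n (fun k => F (- k)).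
Proof.
elim: n => [|n IH]; first by rewrite !bsum0 oppr0.
by rewrite !bsumS IH opprK [F _ + _]addrC.
Qed.

(** The integers 3m, 3m + 1, 3m - 1 with |m| <= n fill exactly the range |k| <= 3n + 1. *)
Lemma bsum3 n F : bsum (3 * n).+1 F = bsum n (fun m => F (3 * m)) +
  bsum n (fun m => F (3 * m + 1)) + bsum n (fun m => F (3 * m - 1)).
Proof.
elim: n => [|n IH]; first by rewrite bsumS !bsum0 mulr0 add0r addrA.
rewrite [in LHS]mulnS !addSn add0n 3!bsumS IH 3!bsumS.
have -> : - (3 * n).+2%:Z = 3 * - n.+1%:Z + 1 by lia.
have -> : - (3 * n).+3%:Z = 3 * - n.+1%:Z by lia.
have -> : - (3 * n).+4%:Z = 3 * - n.+1%:Z - 1 by lia.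
have -> : (3 * n).+2%:Z = 3 * n.+1%:Z - 1 by lia.
have -> : (3 * n).+3%:Z = 3 * n.+1%:Z by lia.
have -> : (3 * n).+4%:Z = 3 * n.+1%:Z + 1 by lia.
ring.
Qed.

Lemma bsum_eqm M n F G : (forall k, (`|k| <= n)%N -> eqm M (F k) (G k)) -> eqm M (bsum n F) (bsum n G).
Proof. by move=> FG; apply: eqm_sum => i _; apply: FG; have := ltn_ord i; lia. Qed.

Lemma bsum_tail M n n' F : (n <= n')%N -> (forall k, (n < `|k|)%N -> eqm M (F k) 0) ->
  eqm M (bsum n' F) (bsum n F).
Proof.
move=> le_nn' F0; rewrite -(subnKC le_nn'); elim: (n' - n)%N => [|d IH]; first by rewrite addn0.
rewrite addnS bsumS -[X in eqm _ _ X]addr0 -[X in eqm _ _ (_ + X)]addr0.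
by apply: eqmD => //; apply: eqmD; apply: F0; lia.
Qed.

Definition term (x y : fps) (k : int) := x ^+ tri k * y ^+ tri (- k).

(** Both exponents are at least C(|k|, 2), so that power of xy divides the term, and C(n, 2) >= n -
    1. *)
Lemma term_small (x y : fps) k : eqm 1 (x * y) 0 -> eqm `|k|.-1 (term x y k) 0.
Proof.
case/eqm0P => g xy.
have [s ->] : exists s, term x y k = (x * y) ^+ 'C(`|k|, 2) * s.
  rewrite /term; case: k => [[|n]|n] /=; first by exists 1; rewrite mulr1.
    by exists (x ^+ n.+1); rewrite [in LHS]binS bin1 exprMn exprD; ring.
  by exists (y ^+ n.+1); rewrite [X in y ^+ X]binS bin1 exprMn exprD; ring.
rewrite xy expr1 exprMn -mulrA; apply: eqm_qn.
case: `|k|%N => [|n] //=; have := bin2_double n; case: n => // n; nia.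
Qed.

(* Ramanujan's f(x, y), the sum of [term x y k] over all integers k. When xy has no
   constant term, the terms with |k| > n + 1 do not contribute to q^n. *)
Definition theta (x y : fps) := FPS (fun n => coef (bsum n.+1 (term x y)) n).

Lemma thetaE (x y : fps) M n : eqm 1 (x * y) 0 -> (M <= n)%N -> eqm M (theta x y) (bsum n (term x y)).
Proof.
move=> xy le_Mn m ltm /=; apply/esym/(@bsum_tail m.+1) => //; first by rewrite (leq_trans ltm).
by move=> k ltk; apply: eqmW (term_small xy); lia.
Qed.

Lemma thetaC (x y : fps) : eqm 1 (x * y) 0 -> theta x y = theta y x.
Proof.
move=> xy; have yx := xy; rewrite mulrC in yx.
apply: eqmP => M; apply: eqm_trans (thetaE xy (leqnn M)) _.
apply/eqm_sym; apply: eqm_trans (thetaE yx (leqnn M)) _.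
rewrite bsumN; apply: bsum_eqm => k _.
by rewrite /term opprK mulrC.
Qed.

(** Comes from splitting the summation index as 3m, 3m + 1, 3m - 1. The equations for a, ..., f let
    a caller supply the monomials in simplified form. *)
Lemma theta_dissect (x y a b c d e f : fps) : eqm 1 (x * y) 0 ->
    a = x ^+ 6 * y ^+ 3 -> b = x ^+ 3 * y ^+ 6 -> c = x ^+ 9 * y ^+ 6 -> d = y ^+ 3 ->
    e = x ^+ 3 -> f = x ^+ 6 * y ^+ 9 ->
  theta x y = theta a b + x * theta c d + y * theta e f.
Proof.
move=> xy -> -> -> -> -> ->.
have small (g h : fps) : g * h = (x * y) ^+ 9 -> eqm 1 (g * h) 0.
  by move=> ->; have := eqmX 9 xy; rewrite expr0n.
apply: eqmP => M.
have [s1 s2 s3] : [/\ eqm 1 ((x ^+ 6 * y ^+ 3) * (x ^+ 3 * y ^+ 6)) 0,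
   eqm 1 ((x ^+ 9 * y ^+ 6) * (y ^+ 3)) 0 & eqm 1 (x ^+ 3 * (x ^+ 6 * y ^+ 9)) 0].
  by split; apply: small; ring.
have t1 := thetaE s1 (leqnn M).
have t2 := eqmM (@eqm_refl M x) (thetaE s2 (leqnn M)).
have t3 := eqmM (@eqm_refl M y) (thetaE s3 (leqnn M)).
apply: eqm_sym; apply: eqm_trans (eqmD (eqmD t1 t2) t3) _ => {t1 t2 t3}.
apply: eqm_sym; apply: eqm_trans (thetaE (n := (3 * M).+1) xy _) _; first by lia.
rewrite bsum3 /bsum !big_distrr /=; apply: eqmD; [apply: eqmD|]; apply: eqm_sum => i _;
  move: (i%:Z - M%:Z) => k; rewrite /term;
  have tk := triE k; have tNk := triE (- k).
- have -> : tri (3 * k) = (6 * tri k + 3 * tri (- k))%N by have := triE (3 * k); nia.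
  have -> : tri (- (3 * k)) = (3 * tri k + 6 * tri (- k))%N by have := triE (- (3 * k)); nia.
  move: (tri k) (tri (- k)) => m n; rewrite (exprMn m (x ^+ 6)) (exprMn n (x ^+ 3)) -!exprM !exprD.
  by rewrite mulrACA.
- have -> : tri (3 * k + 1) = (1 + 9 * tri k)%N by have := triE (3 * k + 1); nia.
  have -> : tri (- (3 * k + 1)) = (6 * tri k + 3 * tri (- k))%N by have := triE (- (3 * k + 1)); nia.
  move: (tri k) (tri (- k)) => m n; rewrite (exprMn m (x ^+ 9)) -!exprM !exprD expr1.
  by rewrite -!mulrA.
- have -> : tri (3 * k - 1) = (3 * tri k + 6 * tri (- k))%N by have := triE (3 * k - 1); nia.
  have -> : tri (- (3 * k - 1)) = (1 + 9 * tri (- k))%N by have := triE (- (3 * k - 1)); nia.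
  move: (tri k) (tri (- k)) => m n; rewrite (exprMn n (x ^+ 6)) -!exprM !exprD expr1.
  by rewrite mulrCA -!mulrA.
Qed.

Lemma prod_geom (R : comNzRingType) (x Q : R) n :
  \prod_(i < n) (x * Q ^+ i) = x ^+ n * Q ^+ 'C(n, 2).
Proof.
elim: n => [|n IH]; first by rewrite big_ord0 mulr1.
by rewrite big_ord_recr IH /= binS bin1 exprD exprS; ring.
Qed.

(* The factors (xy)^n + x (xy)^i of the q-binomial theorem are
   x (xy)^i (1 + y (xy)^(n-1-i)) for i < n and (xy)^n (1 + x (xy)^(i-n)) for i >= n. *)
Lemma finite_triple_product (x y : fps) n : x != 0 -> y != 0 ->
  (\prod_(i < n) (1 + x * (x * y) ^+ i)) * (\prod_(i < n) (1 + y * (x * y) ^+ i)) =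
  bsum n (fun l => term x y l * qbin (x * y) n.*2 (absz (n%:Z + l))).
Proof.
move=> x0 y0; set Q := x * y; have Q0 : Q != 0 by rewrite mulf_neq0.
have c_neq0 : x ^+ n * Q ^+ 'C(n, 2) * Q ^+ (n * n) != 0 by rewrite !mulf_neq0 ?expf_neq0.
apply: (mulfI c_neq0).
transitivity (\prod_(i < n.*2) (Q ^+ n + x * Q ^+ i)).
  have low : \prod_(i < n) (Q ^+ n + x * Q ^+ i) =
      x ^+ n * Q ^+ 'C(n, 2) * \prod_(i < n) (1 + y * Q ^+ i).
    rewrite -prod_geom [X in _ = _ * X](reindex_inj rev_ord_inj) -big_split /=.
    apply: eq_bigr => i _; rewrite -{1}(subnKC (ltn_ord i)) exprD exprS {1}/Q; ring.
  have high : \prod_(i < n) (Q ^+ n + x * Q ^+ (n + i)) =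
      Q ^+ (n * n) * \prod_(i < n) (1 + x * Q ^+ i).
    transitivity (\prod_(i < n) (Q ^+ n * (1 + x * Q ^+ i))).
      by apply: eq_bigr => i _; rewrite exprD; ring.
    by rewrite big_split /= prodr_const card_ord exprM.
  by rewrite -addnn big_split_ord /= low high; ring.
rewrite qbin_thm /bsum big_distrr /=; apply: eq_bigr => i _.
have le_in : (i <= n.*2)%N by rewrite -ltnS.
rewrite addrCA subrr addr0 absz_nat /term /Q.
have := triE (i%:Z - n%:Z); have := triE (- (i%:Z - n%:Z)).
set a := tri _; set b := tri _ => ha hb.
rewrite [LHS](_ : _ = qbin (x * y) n.*2 i *
  (x ^+ ('C(i, 2) + i + n * (n.*2 - i)) * y ^+ ('C(i, 2) + n * (n.*2 - i)))).
  rewrite [RHS](_ : _ = qbin (x * y) n.*2 i *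
    (x ^+ (n + 'C(n, 2) + n * n + b) * y ^+ ('C(n, 2) + n * n + a))).
    have C2 m : ('C(m, 2) * 2 + m = m * m)%N by case: m => // m; rewrite bin2_double; lia.
    have := C2 i; have := C2 n; move: ha hb le_in; clear; move: 'C(i, 2) 'C(n, 2) a b => u v a b.
    move=> ha hb le_in hv hu.
    have e : (n * (n.*2 - i) + n * i = 2 * (n * n))%N by rewrite -mulnDr subnK // -muln2; lia.
    move: e; move: (n * (n.*2 - i))%N => w e.
    by congr (_ * (_ ^+ _ * _ ^+ _)); nia.
  by rewrite !exprD !exprMn; ring.
by rewrite !exprD -exprM !exprMn; ring.
Qed.

Lemma c0_eqm (f : fps) : c0 f = 0 -> eqm 1 f 0.
Proof. by move=> f0 [|n] //. Qed.

Section TripleProduct.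
Variables x y : fps.
Hypotheses (x_neq0 : x != 0) (y_neq0 : y != 0) (c0_xy : c0 (x * y) = 0).
Let Q := x * y.

Let eqm_Qn (s : fps) n : eqm n (s * Q ^+ n) 0.
Proof.
rewrite /Q; have /eqm0P[g ->] := c0_eqm c0_xy.
by rewrite expr1 exprMn mulrCA; apply: eqm_qn.
Qed.

Let eqm_1Qn (s : fps) n : eqm n (1 + s * Q ^+ n) 1.
Proof. by rewrite -[X in eqm _ _ X]addr0; apply: eqmD. Qed.

Let eqm_1Q n : eqm n (1 - Q ^+ n.+1) 1.
Proof. by rewrite -mulN1r; apply: eqmW (eqm_1Qn _ (n := n.+1)). Qed.

Lemma conv_triple : conv (fun i => (1 + x * Q ^+ i) * (1 + y * Q ^+ i) * (1 - Q ^+ i.+1)).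
Proof.
by apply: convM => [|i]; [apply: convM => i | ].
Qed.

Let eqm_qfact N m n : (N <= m)%N -> (N <= n)%N -> eqm N (qfact Q m) (qfact Q n).
Proof.
move=> le_Nm le_Nn; have to_N k : (N <= k)%N -> eqm N (qfact Q k) (qfact Q N).
  move=> le_Nk; apply: (prod_eqm (h := fun i => 1 - Q ^+ i.+1)) => // i.
  by apply: eqmW (@eqm_1Q _); apply: leq_addr.
exact: eqm_trans (to_N _ le_Nm) (eqm_sym (to_N _ le_Nn)).
Qed.

Let c0_qfact n : c0 (qfact Q n) = 1.
Proof.
rewrite /qfact rmorph_prod big1 // => i _.
by rewrite rmorphB rmorph1 rmorphXn /= c0_xy exprS mul0r subr0.
Qed.

(** A Gaussian binomial far from both ends tends to 1 / (Q; Q)_oo: all three q-factorials in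
    [qbin_fact] agree modulo q^M, and one is cancelled as a unit. *)
Let eqm_qbin M m k : (M <= k)%N -> (M <= m)%N -> eqm M (qbin Q (m + k) k * qfact Q M) 1.
Proof.
move=> le_Mk le_Mm; have u := c0_unitr (c0_qfact M).
have e : eqm M (qbin Q (m + k) k * (qfact Q M * qfact Q M)) (qfact Q M).
  apply: eqm_trans (_ : eqm M _ (qfact Q (m + k))) _; last first.
    by apply: eqm_qfact => //; rewrite (leq_trans le_Mm) ?leq_addr.
  rewrite -qbin_fact; apply: eqmM => //; apply: eqmM; exact: eqm_qfact.
have := eqmM e (@eqm_refl M (qfact Q M)^-1).
by rewrite mulrA mulrK // divrr.
Qed.

Lemma jacobi_triple_product :
  theta x y = iprod (fun i => (1 + x * Q ^+ i) * (1 + y * Q ^+ i) * (1 - Q ^+ i.+1)).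
Proof.
apply: iprod_lim; first exact: conv_triple.
(* With n = 2M + 2, an index |k| <= M + 1 keeps n + k and n - k above M, so the binomial is at its
   limit; for larger |k| the term itself vanishes modulo q^M. *)
move=> M; have [n def_n] : exists n, n = M.*2.+2 by eexists.
have le_Mn : (M <= n)%N by lia.
exists n => //; have xy := c0_eqm c0_xy.
apply: eqm_trans (thetaE xy le_Mn) _; apply: eqm_sym.
rewrite 2!big_split /= finite_triple_product // -/(qfact Q n) /bsum big_distrl /= -/Q.
apply: eqm_sum => i _; have := ltn_ord i; move eqk : (i%:Z - n%:Z) => k lt_i.
have [le_kM|lt_Mk] := leqP (absz k) M.+1.
  rewrite -mulrA -[X in eqm _ _ X]mulr1; apply: eqmM => //.
  have -> : n.*2 = (absz (n%:Z - k)%R + absz (n%:Z + k)%R)%N by lia.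
  apply: eqm_trans (_ : eqm M
    (qbin Q (absz (n%:Z - k)%R + absz (n%:Z + k)%R) (absz (n%:Z + k)) * qfact Q M) _).
    by apply: eqmM => //; apply: eqm_qfact.
  by apply: eqm_qbin; lia.
have t0 : eqm M (term x y k) 0 by apply: eqmW (term_small xy); lia.
rewrite -mulrA; apply: eqm_trans (eqmM t0 (@eqm_refl M _)) _.
by rewrite mul0r; apply: eqm_sym.
Qed.
End TripleProduct.

(** * Theta functions as eta quotients *)

Lemma iprodM3 h1 h2 h3 : conv h1 -> conv h2 -> conv h3 ->
  iprod (fun i => h1 i * h2 i * h3 i) = iprod h1 * iprod h2 * iprod h3.
Proof. by move=> c1 c2 c3; rewrite iprodM ?(iprodM c1) //; apply: convM. Qed.

Lemma iprod_recl h : conv h -> iprod h = h 0 * iprod (fun i => h i.+1).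
Proof.
move=> ch; have ch' : conv (fun i => h i.+1) by move=> i; apply: eqmW (ch _).
apply/esym/iprod_lim => // M; exists M.+1; first exact: leqnSn.
by rewrite big_ord_recl; apply: eqmM => //; apply: iprodE.
Qed.

Lemma V_recl m r : (0 < m)%N -> V m r = (1 + q ^+ r) * V m (r + m).
Proof.
move=> m0; rewrite /V iprod_recl; last exact: conv_V.
rewrite muln0 addn0; congr (_ * _); apply: eq_iprod => i.
by rewrite mulnS addnA.
Qed.

Definition E a := W a a.

Lemma E_split2 a : (0 < a)%N -> E a = W (2 * a) a * E (2 * a).
Proof.
move=> a0; rewrite /E (@W_split 2) // !big_ord_recl big_ord0 /= mulr1.
by congr (W _ _ * W _ _); rewrite /bump /=; lia.
Qed.

Lemma E_split3 a : (0 < a)%N -> E a = W (3 * a) a * W (3 * a) (2 * a) * E (3 * a).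
Proof.
move=> a0; rewrite /E (@W_split 3) // !big_ord_recl big_ord0 /= mulr1 mulrA.
by congr (W _ _ * W _ _ * W _ _); rewrite /bump /=; lia.
Qed.

Lemma q_neq0 : q != 0.
Proof. by apply/eqP => /(congr1 (fun f => coef f 1)). Qed.

Lemma c0_q : c0 q = 0. Proof. by []. Qed.

Lemma c0_qn n : (0 < n)%N -> c0 (q ^+ n) = 0.
Proof. by case: n => // n _; rewrite rmorphXn /= c0_q exprS mul0r. Qed.

(** [theta 1 q] is 2 psi(q); the factor 2 is the first factor 1 + q^0 of (-1; q)_oo. *)
Lemma theta_1q : theta 1 q * E 1 = 2 * E 2 ^+ 2.
Proof.
have -> : theta 1 q = V 1 0 * V 1 1 * W 1 1.
  rewrite jacobi_triple_product ?oner_neq0 ?q_neq0 ?mul1r //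
    -iprodM3; [|exact: conv_V|exact: conv_V|exact: conv_W].
  by apply: eq_iprod => i /=; rewrite !mul1r !mul1n !add1n add0n -exprS.
rewrite V_recl // expr0; have := @VW 1 1 isT; rewrite -/(E 2) -/(E 1) => <-; ring.
Qed.

Lemma theta_q_q2 : theta q (q ^+ 2) * (E 1 * E 6) = E 2 * E 3 ^+ 2.
Proof.
have -> : theta q (q ^+ 2) = V 3 1 * V 3 2 * W 3 3.
  rewrite jacobi_triple_product ?expf_neq0 ?q_neq0 -?exprS ?c0_qn //
    -iprodM3; [|exact: conv_V|exact: conv_V|exact: conv_W].
  by apply: eq_iprod => i /=; rewrite -!exprM -!exprD -!exprS mulnS.
rewrite (E_split3 (a := 1)) // (E_split3 (a := 2)) // !muln1.
by rewrite -[W (3 * 2) 2](@VW 3 1) // -[W (3 * 2) (2 * 2)](@VW 3 2) // -/(E 3); ring.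
Qed.

Lemma theta_phi : theta (- q) (- q) * E 2 = E 1 ^+ 2.
Proof.
have -> : theta (- q) (- q) = W 2 1 * W 2 1 * W 2 2.
  rewrite jacobi_triple_product ?oppr_eq0 ?q_neq0 ?mulrNN -?expr2 ?c0_qn //
    -iprodM3; [|exact: conv_W|exact: conv_W|exact: conv_W].
  by apply: eq_iprod => i /=; rewrite !mulNr -!exprM -!exprS mulnS.
by rewrite (E_split2 (a := 1)) // muln1 -/(E 2); ring.
Qed.

(** All products are split into residue classes modulo 6, of which the theta function contains 1, 5
    and 6. *)
Lemma theta_q_q5 : theta (- q) (- q ^+ 5) * (E 2 * E 3) = E 1 * E 6 ^+ 2.
Proof.
have -> : theta (- q) (- q ^+ 5) = W 6 1 * W 6 5 * W 6 6.
  rewrite jacobi_triple_product ?oppr_eq0 ?expf_neq0 ?q_neq0 ?mulrNN -?exprS ?c0_qn //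
    -iprodM3; [|exact: conv_W|exact: conv_W|exact: conv_W].
  by apply: eq_iprod => i /=; rewrite !mulNr -!exprM -!exprD -!exprS mulnS.
rewrite [E 1](@W_split 6) // !big_ord_recl big_ord0 mulr1 /=.
rewrite [E 2](@W_split 3) // !big_ord_recl big_ord0 mulr1 /=.
rewrite [E 3](@W_split 2) // !big_ord_recl big_ord0 mulr1 /= /bump /=.
by rewrite /E !muln1 /muln /= /addn /=; ring.
Qed.

Lemma theta_dil a (x y : fps) : (0 < a)%N -> c0 (x * y) = 0 ->
  dil a (theta x y) = theta (dil a x) (dil a y).
Proof.
case: a => // a _ xy; apply: eqmP => M.
apply: eqm_trans (dil_eqm _ (thetaE (c0_eqm xy) (leqnn M))) _ => //.
apply: eqm_sym; apply: eqm_trans (thetaE (c0_eqm _) (leqnn M)) _.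
  by rewrite -rmorphM c0_dil.
rewrite rmorph_sum /=; apply: eqm_sum => i _.
by rewrite /term rmorphM !rmorphXn.
Qed.

(** Two of the three components are theta functions of the same pair in opposite orders, so they
    coincide and give the factor 2; no exponent congruent to 2 modulo 3 occurs. *)
Lemma theta_1q_dissect :
  theta 1 q = dil 3 (2 * theta q (q ^+ 2)) + q * dil 3 (dil 3 (theta 1 q)).
Proof.
have xy : eqm 1 (1 * q) 0 by apply: c0_eqm; rewrite mul1r.
have q3 : dil 3 q = q ^+ 3 by rewrite -[q in LHS]expr1 dil_qn.
have q9 : dil 9 q = q ^+ 9 by rewrite -[q in LHS]expr1 dil_qn.
have e9 : dil 3 (dil 3 (theta 1 q)) = theta 1 (q ^+ 9).
  by rewrite dil_dil // theta_dil ?mul1r // rmorph1 /= q9.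
have e3 : dil 3 (2 * theta q (q ^+ 2)) = 2 * theta (q ^+ 3) (q ^+ 6).
  rewrite rmorphM rmorph_nat /= theta_dil -?exprS ?c0_qn // rmorphXn /= q3 -exprM.
  by rewrite [(3 * 2)%N](_ : _ = 6%N).
have sym : theta (q ^+ 6) (q ^+ 3) = theta (q ^+ 3) (q ^+ 6).
  by apply: thetaC; apply: c0_eqm; rewrite -exprD c0_qn.
rewrite e9 e3; apply: etrans (theta_dissect (a := q ^+ 3) (b := q ^+ 6) (c := q ^+ 6)
  (d := q ^+ 3) (e := 1) (f := q ^+ 9) xy _ _ _ _ _ _) _; rewrite ?expr1n ?mul1r //.
have comb (a b c : fps) : b = a -> a + b + q * c = 2 * a + q * c by move=> ->; ring.
exact: comb sym.
Qed.

(** The components of the indices 3m + 1 and 3m - 1 coincide by symmetry, whence the factor 2. *)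
Lemma theta_phi_dissect :
  theta (- q) (- q) = dil 3 (dil 3 (theta (- q) (- q))) + q * dil 3 (- (2 * theta (- q) (- q ^+ 5))).
Proof.
have xy : c0 (- q * - q) = 0 by rewrite mulrNN -expr2 c0_qn.
have xy5 : c0 (- q * - q ^+ 5) = 0 by rewrite mulrNN -exprS c0_qn.
have q3 : dil 3 q = q ^+ 3 by rewrite -[q in LHS]expr1 dil_qn.
have q9 : dil 9 q = q ^+ 9 by rewrite -[q in LHS]expr1 dil_qn.
have e9 : dil 3 (dil 3 (theta (- q) (- q))) = theta (- q ^+ 9) (- q ^+ 9).
  by rewrite dil_dil // theta_dil // rmorphN /= q9.
have e3 : dil 3 (- (2 * theta (- q) (- q ^+ 5))) = - (2 * theta (- q ^+ 3) (- q ^+ 15)).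
  rewrite rmorphN rmorphM rmorph_nat /= theta_dil // !rmorphN rmorphXn /= q3 -exprM.
  by rewrite [(3 * 5)%N](_ : _ = 15%N).
have sym : theta (- q ^+ 15) (- q ^+ 3) = theta (- q ^+ 3) (- q ^+ 15).
  by apply: thetaC; apply: c0_eqm; rewrite mulrNN -exprD c0_qn.
rewrite e9 e3; apply: etrans (theta_dissect (a := - q ^+ 9) (b := - q ^+ 9)
  (c := - q ^+ 15) (d := - q ^+ 3) (e := - q ^+ 3) (f := - q ^+ 15) (c0_eqm xy) _ _ _ _ _ _) _;
  [ring|ring|ring|ring|ring|ring|].
have comb (a b c : fps) : b = c -> a + - q * b + - q * c = a + q * - (2 * c) by move=> ->; ring.
exact: comb sym.
Qed.

(** * Two identities of level 6 *)

Definition part r (f : fps) := FPS (fun n => coef f (3 * n + r)%N).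

(* The norm of Z[[q]] over Z[[q^3]], with q^3 then replaced by q. *)
Definition norm3 f := part 0 f ^+ 3 + q * part 1 f ^+ 3 + q ^+ 2 * part 2 f ^+ 3
  - 3 * q * part 0 f * part 1 f * part 2 f.

Lemma coef_dil3 (f : fps) r s n : (r < 3)%N -> (s < 3)%N ->
  coef (q ^+ r * dil 3 f) (3 * n + s) = if r == s then coef f n else 0.
Proof.
move=> r3 s3; rewrite coef_qnM /= /sdil; case: leqP => [le_rs|lt_sr]; last first.
  by rewrite gtn_eqF //; lia.
case: eqP => [->|ne]; first by rewrite addnK dvdn_mulr // mulKn.
by rewrite (_ : (3 %| _)%N = false) //; lia.
Qed.

Lemma part_dil3 f g h : let F := dil 3 f + q * dil 3 g + q ^+ 2 * dil 3 h in
  (part 0 F = f) * (part 1 F = g) * (part 2 F = h).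
Proof.
move=> F; have coefF r n : (r < 3)%N -> coef F (3 * n + r) = nth 0 [:: coef f n; coef g n; coef h n] r.
  move=> r3; rewrite /F -[dil 3 f]mul1r -(expr0 q) -[q * _](congr1 (fun x => x * _) (expr1 q)).
  rewrite -[LHS]/(coef _ _ + coef _ _ + coef _ _) !coef_dil3 //.
  by case: r r3 => [|[|[|]]] //=; rewrite ?add0r ?addr0.
split; [split|]; apply: fpsP => n.
- exact: (coefF 0%N).
- exact: (coefF 1%N).
- exact: (coefF 2%N).
Qed.

Lemma dil3_part f : f = dil 3 (part 0 f) + q * dil 3 (part 1 f) + q ^+ 2 * dil 3 (part 2 f).
Proof.
apply: fpsP => n; rewrite (divn_eq n 3) mulnC; have r3 := ltn_pmod n (isT : 0 < 3)%N.
set r := (n %% 3)%N in r3 *; set m := (n %/ 3)%N.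
rewrite -[dil 3 (part 0 f)]mul1r -(expr0 q) -{2}[q](expr1 q).
rewrite -[RHS]/(coef _ _ + coef _ _ + coef _ _) !coef_dil3 //.
by case: r r3 => [|[|[|]]] //= _; rewrite ?add0r ?addr0 ?addn0.
Qed.

Lemma norm3_dil f g h : norm3 (dil 3 f + q * dil 3 g + q ^+ 2 * dil 3 h) =
  f ^+ 3 + q * g ^+ 3 + q ^+ 2 * h ^+ 3 - 3 * q * f * g * h.
Proof. by rewrite /norm3 !part_dil3. Qed.

Lemma dil3_q : dil 3 q = q ^+ 3.
Proof. by rewrite -[q in LHS]expr1 dil_qn. Qed.

(** Written in the basis 1, q, q^2 over Z[[q^3]], multiplicativity of the norm is a polynomial
    identity in the six components. *)
Lemma norm3M : {morph norm3 : f g / f * g}.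
Proof.
move=> f g; rewrite (dil3_part f) (dil3_part g).
move: (part 0 f) (part 1 f) (part 2 f) (part 0 g) (part 1 g) (part 2 g) => f0 f1 f2 g0 g1 g2.
rewrite !norm3_dil.
have -> : (dil 3 f0 + q * dil 3 f1 + q ^+ 2 * dil 3 f2) * (dil 3 g0 + q * dil 3 g1 + q ^+ 2 * dil 3 g2) =
  dil 3 (f0 * g0 + q * (f1 * g2 + f2 * g1)) + q * dil 3 (f0 * g1 + f1 * g0 + q * (f2 * g2))
  + q ^+ 2 * dil 3 (f0 * g2 + f1 * g1 + f2 * g0).
  by rewrite !(rmorphD, rmorphM) /= dil3_q; ring.
by rewrite norm3_dil; ring.
Qed.

Lemma norm3_dil3 f : norm3 (dil 3 f) = f ^+ 3.
Proof.
have := norm3_dil f 0 0; rewrite rmorph0 !mulr0 !addr0 => ->.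
by rewrite expr0n !mulr0 subr0 !addr0.
Qed.

Lemma norm3_1 : norm3 1 = 1.
Proof. by have := norm3_dil3 1; rewrite rmorph1 expr1n. Qed.

Lemma norm3_eqm M f g : eqm (3 * M) f g -> eqm M (norm3 f) (norm3 g).
Proof.
move=> fg; have part_eqm r : (r < 3)%N -> eqm M (part r f) (part r g).
  by move=> r3 n ltn /=; apply: fg; lia.
have := (part_eqm 0%N isT, part_eqm 1%N isT, part_eqm 2%N isT) => -[[p0 p1] p2].
by apply: eqmD; [apply: eqmD; [apply: eqmD|] | apply: eqmN]; rewrite ?exprS;
  repeat (apply: eqmM => //).
Qed.

(** The norm is the product over the cube roots of unity z of 1 - (z q)^k: this is 1 - q^(3k) if 3
    does not divide k and (1 - q^k)^3 otherwise, before q^3 becomes q. *)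
Lemma norm3_1q k : norm3 (1 - q ^+ k) = if (3 %| k)%N then (1 - q ^+ (k %/ 3)) ^+ 3 else 1 - q ^+ k.
Proof.
case: ifP => [/dvdnP[m ->]|].
  by rewrite mulnK // -norm3_dil3 rmorphB rmorph1 /= dil_qn // mulnC.
have := divn_eq k 3; have := ltn_pmod k (isT : 0 < 3)%N; rewrite /dvdn.
move: (k %% 3)%N (k %/ 3)%N => [|[|[|]]] // m _ -> _.
  have := norm3_dil 1 (- q ^+ m) 0; rewrite rmorph0 rmorph1 rmorphN /= dil_qn // => e.
  transitivity (1 ^+ 3 + q * (- q ^+ m) ^+ 3 + q ^+ 2 * 0 ^+ 3 - 3 * q * 1 * (- q ^+ m) * 0).
    by rewrite -e; congr norm3; rewrite mulnC addnC exprD; ring.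
  by rewrite addnC exprD expr1 exprM; ring.
have := norm3_dil 1 0 (- q ^+ m); rewrite rmorph0 rmorph1 rmorphN /= dil_qn // => e.
transitivity (1 ^+ 3 + q * 0 ^+ 3 + q ^+ 2 * (- q ^+ m) ^+ 3 - 3 * q * 1 * 0 * (- q ^+ m)).
  by rewrite -e; congr norm3; rewrite mulnC addnC exprD; ring.
by rewrite addnC exprD exprM; ring.
Qed.

(** Factors whose exponent is prime to 3 are fixed by the norm and multiply to [E a] / [E (3 * a)];
    the other ones give the cube of [E a]. *)
Lemma norm3_E a : (0 < a)%N -> ~~ (3 %| a)%N -> norm3 (E a) * E (3 * a) = E a ^+ 4.
Proof.
move=> a0 ndiv; rewrite {1}/E /W (iprod_regroup (d := 3)) //; last exact: conv_W.
have F i : norm3 (\prod_(j < 3) (1 - q ^+ (a + a * (3 * i + j)))) =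
   (1 - q ^+ (a + 3 * a * i)) * (1 - q ^+ (2 * a + 3 * a * i)) *
     ((1 - q ^+ (a + a * i)) * ((1 - q ^+ (a + a * i)) * (1 - q ^+ (a + a * i)))).
  rewrite (big_morph _ norm3M norm3_1) !big_ord_recl big_ord0 !norm3_1q /= /bump /=.
  have -> : (3 %| a + a * (3 * i + 0))%N = false by apply/negbTE; move: ndiv; lia.
  have -> : (3 %| a + a * (3 * i + (1 + 0)))%N = false by apply/negbTE; move: ndiv; lia.
  have e : (a + a * (3 * i + (1 + (1 + 0))) = (a + a * i) * 3)%N by lia.
  rewrite e dvdn_mull // mulnK // mulr1 -!mulrA.
  by congr ((1 - q ^+ _) * ((1 - q ^+ _) * _)); lia.
have cW := conv_W; have a30 : (0 < 3 * a)%N by rewrite muln_gt0.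
rewrite (iprod_map (F := norm3)).
- rewrite (eq_iprod F) iprodM3 ?iprodM //; do ?[exact: cW | apply: convM].
  rewrite -/(W (3 * a) a) -/(W (3 * a) (2 * a)) -/(W a a) -/(E a).
  by rewrite exprS {4}(E_split3 a0); ring.
- exact: (@conv_regroup 3 (fun m => 1 - q ^+ (a + a * m)) isT (@conv_W a a a0)).
- by move=> i; rewrite F; do !apply: eqmM1; apply: cW.
- exact: norm3_1.
- exact: norm3M.
- by move=> M; exists (3 * M)%N => f g; apply: norm3_eqm.
Qed.

Lemma c0_E a : (0 < a)%N -> c0 (E a) = 1. Proof. exact: c0_W. Qed.

Lemma E_neq0 a : (0 < a)%N -> E a != 0.
Proof. by move/c0_E/c0_neq0. Qed.

Lemma dil_E a b : (0 < a)%N -> (0 < b)%N -> dil a (E b) = E (a * b).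
Proof. by move=> a0 b0; rewrite /E dil_W. Qed.

Lemma natr_fps_neq0 n : n.+1%:R != 0 :> fps.
Proof.
apply/eqP => /(congr1 c0); rewrite rmorph_nat rmorph0 => /eqP.
by rewrite pnatr_eq0.
Qed.

Lemma norm3_2 : norm3 2 = 8.
Proof. by have := norm3_dil3 2; rewrite rmorph_nat => ->; ring. Qed.

Lemma level6_xi : E 2 ^+ 8 * E 3 ^+ 4 * E 6 = E 1 * E 2 ^+ 3 * E 3 ^+ 9 + q * E 1 ^+ 4 * E 6 ^+ 9.
Proof.
have hA := theta_q_q2; have ht := theta_1q.
have ht3 := congr1 (dil 3) ht; rewrite 2!rmorphM rmorph_nat rmorphXn /= !dil_E // in ht3.
have hN := congr1 norm3 ht; rewrite !expr2 !norm3M norm3_2 theta_1q_dissect in hN.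
have := norm3_dil (2 * theta q (q ^+ 2)) (dil 3 (theta 1 q)) 0.
rewrite rmorph0 mulr0 addr0 => eN; rewrite eN {eN} in hN.
have n1 := @norm3_E 1 isT isT; have n2 := @norm3_E 2 isT isT.
have c_neq0 : 8 * E 1 ^+ 3 * E 6 ^+ 2 != 0 by rewrite !mulf_neq0 ?expf_neq0 ?natr_fps_neq0 ?E_neq0.
apply: (mulfI c_neq0).
move: ht3 hA hN n1 n2; rewrite -[(3 * 1)%N]/3%N -[(3 * 2)%N]/6%N {ht c_neq0}.
move: (dil 3 _) (theta q _) (norm3 (E 1)) (norm3 (E 2)) => t A N1 N2.
move: (E 1) (E 2) (E 3) (E 6) => e1 e2 e3 e6 ht hA hN hn1 hn2.
(* The norm identity is multiplied by E1^3 E3^4 E6^5, which clears the denominators of both norms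
   and both theta values. *)
transitivity (8 * (N2 * N2) * (e1 ^+ 3 * e3 ^+ 4 * e6 ^+ 5)).
  transitivity (8 * (e2 ^+ 4) ^+ 2 * (e1 ^+ 3 * e3 ^+ 4 * e6 ^+ 3)); first by ring.
  by rewrite -hn2; ring.
rewrite -hN.
transitivity ((8 * (A * (e1 * e6)) ^+ 3 * e3 ^+ 3 + q * (t * e3) ^+ 3 * e1 ^+ 3 * e6 ^+ 3) *
  (N1 * e3) * e6 ^+ 2); first by ring.
by rewrite hA ht hn1; ring.
Qed.

Lemma level6_phi : E 1 ^+ 8 * E 3 * E 6 ^+ 4 = E 2 ^+ 4 * E 3 ^+ 9 - 8 * q * E 1 ^+ 3 * E 2 * E 6 ^+ 9.
Proof.
have hB := theta_q_q5; have ht := theta_phi.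
have ht3 := congr1 (dil 3) ht; rewrite rmorphM rmorphXn /= !dil_E // in ht3.
have hN := congr1 norm3 ht; rewrite !expr2 !norm3M theta_phi_dissect in hN.
have := norm3_dil (dil 3 (theta (- q) (- q))) (- (2 * theta (- q) (- q ^+ 5))) 0.
rewrite rmorph0 mulr0 addr0 => eN; rewrite eN {eN} in hN.
have n1 := @norm3_E 1 isT isT; have n2 := @norm3_E 2 isT isT.
have c_neq0 : E 2 ^+ 3 * E 3 ^+ 2 != 0 by rewrite mulf_neq0 ?expf_neq0 ?E_neq0.
apply: (mulfI c_neq0).
move: ht3 hB hN n1 n2; rewrite -[(3 * 1)%N]/3%N -[(3 * 2)%N]/6%N {ht c_neq0}.
move: (dil 3 _) (theta _ (- q ^+ 5)) (norm3 (E 1)) (norm3 (E 2)) => t B N1 N2.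
move: (E 1) (E 2) (E 3) (E 6) => e1 e2 e3 e6 ht hB hN hn1 hn2.
transitivity (N1 * N1 * (e2 ^+ 3 * e3 ^+ 5 * e6 ^+ 4)).
  transitivity ((e1 ^+ 4) ^+ 2 * (e2 ^+ 3 * e3 ^+ 3 * e6 ^+ 4)); first by ring.
  by rewrite -hn1; ring.
rewrite -hN.
transitivity (((t * e6) ^+ 3 * e2 ^+ 3 * e3 ^+ 3 - 8 * q * (B * (e2 * e3)) ^+ 3 * e6 ^+ 3) *
  (N2 * e6) * e3 ^+ 2); first by ring.
by rewrite hB ht hn2; ring.
Qed.

(** * Identities of level 12 *)

Lemma conj_E_even a : (0 < a)%N -> conj (E (2 * a)) = E (2 * a).
Proof. by move=> a0; rewrite -dil_E // conj_dil2. Qed.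

(** Only the odd-exponent part (q; q^2)_oo changes, into (-q; q^2)_oo, and the product of these two
    is (q^2; q^4)_oo = E2 / E4. *)
Lemma conj_E1 : conj (E 1) * (E 1 * E 4) = E 2 ^+ 3.
Proof.
have E1 := @E_split2 1 isT; have E2 := @E_split2 2 isT; rewrite !muln1 in E1.
have VW21 := @VW 2 1 isT.
have conjW : conj (W 2 1) = V 2 1.
  have F i : conj (1 - q ^+ (1 + 2 * i)) = 1 + q ^+ (1 + 2 * i).
    by rewrite rmorphB rmorph1 rmorphXn /= conj_q exprNn -signr_odd oddD oddM mulN1r opprK.
  rewrite /W (iprod_map (F := conj)).
  - exact: eq_iprod.
  - exact: conv_W.
  - by move=> i; rewrite F; apply: conv_V.
  - exact: rmorph1.
  - exact: rmorphM.
  - by move=> M; exists M => f g; apply: conj_eqm.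
rewrite {1}E1 rmorphM /= conjW (@conj_E_even 1) // E1.
transitivity (V 2 1 * W 2 1 * E 4 * E 2 ^+ 2); first by ring.
by rewrite VW21 -E2; ring.
Qed.

Lemma conj_E3 : conj (E 3) * (E 3 * E 12) = E 6 ^+ 3.
Proof.
have := congr1 (dil 3) conj_E1.
by rewrite 2!rmorphM rmorphXn /= -conj_dil3 !dil_E.
Qed.

Section Level12.
Variable K : fieldType.

(* u = E4^4 E6^2 / (q E2^2 E12^4) is a Hauptmodul of Gamma_0(12), odd in q;
   p = u + 1 and r = u + 3 are eta quotients as well, and p', r' are their images
   under q -> -q. *)
Lemma level12_sum (u p p' r r' : K) :
    p * p' = 1 - u ^+ 2 -> r * r' = 9 - u ^+ 2 ->
    u * r = p ^+ 2 - p' -> - u * r' = p' ^+ 2 - p ->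
  p + p' = 2 \/ (p + p' + 1) ^+ 2 + 3 * u ^+ 2 = 0.
Proof.
move=> h1 h2 h3 h4.
(* Multiplying the last two hypotheses and eliminating r r' gives S^3 - 3 (1 - u^2) S - 2 - 6 u^2 =
   0 for S = p + p', and 2 is a root of this cubic. *)
have : (p + p' - 2) * ((p + p' + 1) ^+ 2 + 3 * u ^+ 2) = 0.
  have h5 : - u ^+ 2 * (r * r') = (p * p') ^+ 2 - p ^+ 3 - p' ^+ 3 + p * p'.
    transitivity ((u * r) * (- u * r')); first by ring.
    by rewrite h3 h4; ring.
  have h6 : (p + p') ^+ 3 - 3 * (p * p') * (p + p') = 2 + 6 * u ^+ 2.
    transitivity (u ^+ 2 * (r * r') + (p * p') ^+ 2 + p * p').
      have -> : u ^+ 2 * (r * r') = - (- u ^+ 2 * (r * r')) by ring.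
      by rewrite h5; ring.
    by rewrite h1 h2; ring.
  transitivity ((p + p') ^+ 3 - 3 * (1 - u ^+ 2) * (p + p') - (2 + 6 * u ^+ 2)); first by ring.
  by rewrite -h1 h6 subrr.
by move/eqP; rewrite mulf_eq0 subr_eq0 => /orP[/eqP|/eqP]; [left|right].
Qed.

Lemma level12_root (u p p' : K) : p * p' = 1 - u ^+ 2 -> p + p' = 2 -> p = 1 + u \/ p = 1 - u.
Proof.
move=> h1 hs; have : (p - (1 + u)) * (p - (1 - u)) = 0.
  transitivity (p ^+ 2 - p * 2 + (1 - u ^+ 2)); first by ring.
  by rewrite -h1 -hs; ring.
by move/eqP; rewrite mulf_eq0 !subr_eq0 => /orP[/eqP|/eqP]; [left|right].
Qed.

Variables q e1 e2 e3 e4 e6 e12 : K.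
Hypotheses (q0 : q != 0) (e1n0 : e1 != 0) (e2n0 : e2 != 0) (e3n0 : e3 != 0)
  (e4n0 : e4 != 0) (e6n0 : e6 != 0) (e12n0 : e12 != 0).

Lemma eta_kappa :
  (e2 ^+ 5 * e4 ^+ 5 * (e12 ^+ 5 / e6 ^+ 15)) ^+ 2 / (e1 ^+ 5 * e2 ^+ 5 * (e6 ^+ 5 / e3 ^+ 15)) =
  (e2 * e3 ^+ 3 * e4 ^+ 2 * e12 ^+ 2 / (e1 * e6 ^+ 7)) ^+ 5.
Proof.
have nz := (e1n0, e2n0, e3n0, e4n0, e6n0, e12n0).
by field; rewrite !nz.
Qed.

Lemma eta_conj : let e1' := e2 ^+ 3 / (e1 * e4) in let e3' := e6 ^+ 3 / (e3 * e12) in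
  e2 * e3' ^+ 3 * e4 ^+ 2 * e12 ^+ 2 / (e1' * e6 ^+ 7) =
  e1 * e4 ^+ 3 * e6 ^+ 2 / (e2 ^+ 2 * e3 ^+ 3 * e12).
Proof.
have nz := (e1n0, e2n0, e3n0, e4n0, e6n0, e12n0).
by move=> /=; field; rewrite !nz.
Qed.

Lemma eta_mul_conj :
  e2 * e3 ^+ 3 * e4 ^+ 2 * e12 ^+ 2 / (e1 * e6 ^+ 7) *
    (e1 * e4 ^+ 3 * e6 ^+ 2 / (e2 ^+ 2 * e3 ^+ 3 * e12)) = e4 ^+ 5 * e12 / (e2 * e6 ^+ 5).
Proof.
have nz := (e1n0, e2n0, e3n0, e4n0, e6n0, e12n0).
by field; rewrite !nz.
Qed.

(** The first two alternatives are the unwanted factors of the cubic and of the quadratic for p,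
    cleared of denominators so that they can be pulled back to power series and refuted at q = 0. *)
Lemma level12 :
    e2 ^+ 8 * e3 ^+ 4 * e6 = e1 * e2 ^+ 3 * e3 ^+ 9 + q * e1 ^+ 4 * e6 ^+ 9 ->
    (let e1' := e2 ^+ 3 / (e1 * e4) in let e3' := e6 ^+ 3 / (e3 * e12) in
     e2 ^+ 8 * e3' ^+ 4 * e6 = e1' * e2 ^+ 3 * e3' ^+ 9 + (- q) * e1' ^+ 4 * e6 ^+ 9) ->
    e4 ^+ 8 * e6 ^+ 4 * e12 = e2 * e4 ^+ 3 * e6 ^+ 9 + q ^+ 2 * e2 ^+ 4 * e12 ^+ 9 ->
    e2 ^+ 8 * e6 * e12 ^+ 4 = e4 ^+ 4 * e6 ^+ 9 - 8 * q ^+ 2 * e2 ^+ 3 * e4 * e12 ^+ 9 ->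
  let up := e4 ^+ 4 * e6 ^+ 2 in let um := e2 ^+ 2 * e12 ^+ 4 in
  let pp := e3 ^+ 3 * e4 in let pm := e1 * e12 ^+ 3 in
  let p'p := e6 ^+ 9 * e1 * e4 ^+ 2 in let p'm := e3 ^+ 3 * e12 ^+ 6 * e2 ^+ 3 in
  [\/ (pp * p'm * um - p'p * pm * um + q * pm * p'm * um) ^+ 2 + 3 * (up * pm * p'm) ^+ 2 = 0,
      pp * um = q * pm * um - up * pm |
      let a := e2 * e3 ^+ 3 * e4 ^+ 2 * e12 ^+ 2 / (e1 * e6 ^+ 7) in
      let b := e1 * e4 ^+ 3 * e6 ^+ 2 / (e2 ^+ 2 * e3 ^+ 3 * e12) in
      a + b = 2 * (e4 ^+ 5 * e12 / (e2 * e6 ^+ 5)) /\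
      e2 ^+ 5 * e6 / (e1 * e3 ^+ 5) = 3 * b - 2 * b ^+ 2].
Proof.
move=> L L' L2 M2 /=.
have nz := (q0, e1n0, e2n0, e3n0, e4n0, e6n0, e12n0).
set u := e4 ^+ 4 * e6 ^+ 2 / (q * (e2 ^+ 2 * e12 ^+ 4)).
set p := e3 ^+ 3 * e4 / (q * (e1 * e12 ^+ 3)).
set p' := - (e6 ^+ 9 * e1 * e4 ^+ 2) / (q * (e3 ^+ 3 * e12 ^+ 6 * e2 ^+ 3)).
set r := e3 * e2 ^+ 7 / (e1 ^+ 3 * q * e4 ^+ 2 * e6 * e12 ^+ 2).
set r' := - (e6 ^+ 2 * e1 ^+ 3 * e4) / (q * e3 * e2 ^+ 2 * e12 ^+ 3).
have h1 : p * p' = 1 - u ^+ 2.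
  transitivity ((e4 ^+ 8 * e6 ^+ 4 * e12 - e2 * e4 ^+ 3 * e6 ^+ 9) /
      (q ^+ 2 * e2 ^+ 4 * e12 ^+ 9) - u ^+ 2).
    by rewrite /p /p' /u; field; rewrite !nz.
  by rewrite L2; congr (_ - _); field; rewrite !nz.
have h2 : r * r' = 9 - u ^+ 2.
  transitivity ((e4 ^+ 8 * e6 ^+ 4 * e12 - e2 * e4 ^+ 3 * e6 ^+ 9) /
      (q ^+ 2 * e2 ^+ 4 * e12 ^+ 9) +
     (e4 ^+ 4 * e6 ^+ 9 - e2 ^+ 8 * e6 * e12 ^+ 4) / (q ^+ 2 * e2 ^+ 3 * e4 * e12 ^+ 9) - u ^+ 2).
    by rewrite /r /r' /u; field; rewrite !nz.
  by rewrite L2 M2; congr (_ - _); field; rewrite !nz.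
have h3 : u * r = p ^+ 2 - p'.
  transitivity (e2 ^+ 8 * e3 ^+ 4 * e6 * (e4 ^+ 2 / (q ^+ 2 * e12 ^+ 6 * e1 ^+ 3 * e2 ^+ 3 * e3 ^+ 3))).
    by rewrite /u /r; field; rewrite !nz.
  by rewrite L /p /p'; field; rewrite !nz.
have h4 : - u * r' = p' ^+ 2 - p.
  transitivity (e2 ^+ 8 * (e6 ^+ 3 / (e3 * e12)) ^+ 4 * e6 *
      (e4 ^+ 5 * e1 ^+ 3 * e3 ^+ 3 / (q ^+ 2 * e2 ^+ 12 * e12 ^+ 3 * e6 ^+ 9))).
    by rewrite /u /r'; field; rewrite !nz.
  by rewrite L' /p /p'; field; rewrite !nz.
have a_eq : e2 * e3 ^+ 3 * e4 ^+ 2 * e12 ^+ 2 / (e1 * e6 ^+ 7) = - (u / p').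
  by rewrite /u /p'; field; rewrite !nz oppr_eq0 !mulf_neq0 ?expf_neq0.
have b_eq : e1 * e4 ^+ 3 * e6 ^+ 2 / (e2 ^+ 2 * e3 ^+ 3 * e12) = u / p.
  by rewrite /u /p; field; rewrite !nz.
have x_eq : e4 ^+ 5 * e12 / (e2 * e6 ^+ 5) = - (u ^+ 2 / (p * p')).
  by rewrite /u /p /p'; field; rewrite !nz oppr_eq0 !mulf_neq0 ?expf_neq0.
have xi_eq : e2 ^+ 5 * e6 / (e1 * e3 ^+ 5) = u * r / p ^+ 2.
  by rewrite /u /p /r; field; rewrite !nz.
have p_neq0 : p != 0 by rewrite /p !(mulf_neq0, invr_neq0, expf_neq0).
have p'_neq0 : p' != 0 by rewrite /p' !(mulf_neq0, invr_neq0, expf_neq0, oppr_eq0).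
have [hs|h0] := level12_sum h1 h2 h3 h4; last first.
  constructor 1; transitivity (((p + p' + 1) ^+ 2 + 3 * u ^+ 2) *
    (q * (e1 * e12 ^+ 3) * (e3 ^+ 3 * e12 ^+ 6 * e2 ^+ 3) * (e2 ^+ 2 * e12 ^+ 4)) ^+ 2).
    by rewrite /p /p' /u; field; rewrite !nz.
  by rewrite h0 mul0r.
have [hp|hp] := level12_root h1 hs; last first.
  constructor 2; transitivity (p * (q * (e1 * e12 ^+ 3) * (e2 ^+ 2 * e12 ^+ 4))).
    by rewrite /p; field; rewrite !nz.
  by rewrite hp /u; field; rewrite !nz.
(* Now p = 1 + u and p' = 1 - u, so a = u / (u - 1), b = u / (u + 1), x = u^2 / (u^2 - 1) and xi = u
   (u + 3) / (u + 1)^2. *)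
constructor 3; rewrite a_eq b_eq x_eq xi_eq h3.
have p'E : p' = 1 - u by rewrite -[p'](addKr p) hs hp; ring.
move: p_neq0 p'_neq0; rewrite p'E hp => n1 n2.
by split; field; rewrite ?n1 ?n2.
Qed.
End Level12.

(** * From the fraction field back to power series *)

Section Transfer.
Variables (R : idomainType) (K : fieldType) (frac : {rmorphism R -> K}).
Hypothesis frac_inj : injective frac.
Variables (q e1 e2 e3 e4 e6 e12 : R).
Hypotheses (q0 : q != 0) (u1 : e1 \is a GRing.unit) (u2 : e2 \is a GRing.unit)
  (u3 : e3 \is a GRing.unit) (u4 : e4 \is a GRing.unit) (u6 : e6 \is a GRing.unit)
  (u12 : e12 \is a GRing.unit).

Let unit_neq0 (x : R) : x \is a GRing.unit -> frac x != 0.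
Proof. by move=> ux; rewrite -unitfE rmorph_unit. Qed.

Let nz1 := unit_neq0 u1.
Let nz2 := unit_neq0 u2.
Let nz3 := unit_neq0 u3.
Let nz4 := unit_neq0 u4.
Let nz6 := unit_neq0 u6.
Let nz12 := unit_neq0 u12.
Let units := (u1, u2, u3, u4, u6, u12).

Let fracE := (@rmorphM _ _ frac, @rmorphXn _ _ frac, @rmorphD _ _ frac, @rmorphB _ _ frac,
  @rmorphN _ _ frac, @rmorphV _ _ frac, @rmorph_nat _ _ frac).

(** The eta products are units, so the embedding into the fraction field preserves their inverses
    and the field identity descends by injectivity. *)
Lemma eta_kappa_unit :
  (e2 ^+ 5 * e4 ^+ 5 * (e12 ^+ 5 / e6 ^+ 15)) ^+ 2 / (e1 ^+ 5 * e2 ^+ 5 * (e6 ^+ 5 / e3 ^+ 15)) =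
  (e2 * e3 ^+ 3 * e4 ^+ 2 * e12 ^+ 2 / (e1 * e6 ^+ 7)) ^+ 5.
Proof.
apply: frac_inj.
rewrite !fracE ?(unitrM, unitrX, unitrV, units) //.
exact: eta_kappa.
Qed.

Lemma eta_mul_conj_unit :
  e2 * e3 ^+ 3 * e4 ^+ 2 * e12 ^+ 2 / (e1 * e6 ^+ 7) *
    (e1 * e4 ^+ 3 * e6 ^+ 2 / (e2 ^+ 2 * e3 ^+ 3 * e12)) = e4 ^+ 5 * e12 / (e2 * e6 ^+ 5).
Proof.
apply: frac_inj.
rewrite !fracE ?(unitrM, unitrX, unitrV, units) //.
exact: eta_mul_conj.
Qed.

Variables e1' e3' : R.
Hypotheses (he1' : e1' * (e1 * e4) = e2 ^+ 3) (he3' : e3' * (e3 * e12) = e6 ^+ 3).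

Let fe1' : frac e1' = frac e2 ^+ 3 / (frac e1 * frac e4).
Proof. by rewrite -rmorphXn -he1' !rmorphM mulfK // mulf_neq0. Qed.

Let fe3' : frac e3' = frac e6 ^+ 3 / (frac e3 * frac e12).
Proof. by rewrite -rmorphXn -he3' !rmorphM mulfK // mulf_neq0. Qed.

Let u1' : e1' \is a GRing.unit.
Proof.
have: e2 ^+ 3 \is a GRing.unit by rewrite unitrX.
by rewrite -he1' unitrM => /andP[].
Qed.

Lemma eta_conj_unit :
  e2 * e3' ^+ 3 * e4 ^+ 2 * e12 ^+ 2 / (e1' * e6 ^+ 7) =
  e1 * e4 ^+ 3 * e6 ^+ 2 / (e2 ^+ 2 * e3 ^+ 3 * e12).
Proof.
apply: frac_inj.
rewrite !fracE ?(unitrM, unitrX, unitrV, units, u1') // fe1' fe3'.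
exact: eta_conj.
Qed.

(** The morphism c takes constant terms. It turns the first alternative of [level12] into 3 = 0 and
    the second into 1 = -1. *)
Lemma level12_unit (c : {rmorphism R -> int}) :
    c q = 0 -> [/\ c e1 = 1, c e2 = 1 & c e3 = 1] -> [/\ c e4 = 1, c e6 = 1 & c e12 = 1] ->
    e2 ^+ 8 * e3 ^+ 4 * e6 = e1 * e2 ^+ 3 * e3 ^+ 9 + q * e1 ^+ 4 * e6 ^+ 9 ->
    e2 ^+ 8 * e3' ^+ 4 * e6 = e1' * e2 ^+ 3 * e3' ^+ 9 + (- q) * e1' ^+ 4 * e6 ^+ 9 ->
    e4 ^+ 8 * e6 ^+ 4 * e12 = e2 * e4 ^+ 3 * e6 ^+ 9 + q ^+ 2 * e2 ^+ 4 * e12 ^+ 9 ->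
    e2 ^+ 8 * e6 * e12 ^+ 4 = e4 ^+ 4 * e6 ^+ 9 - 8 * q ^+ 2 * e2 ^+ 3 * e4 * e12 ^+ 9 ->
  let a := e2 * e3 ^+ 3 * e4 ^+ 2 * e12 ^+ 2 / (e1 * e6 ^+ 7) in
  let b := e1 * e4 ^+ 3 * e6 ^+ 2 / (e2 ^+ 2 * e3 ^+ 3 * e12) in
  a + b = 2 * (e4 ^+ 5 * e12 / (e2 * e6 ^+ 5)) /\
  e2 ^+ 5 * e6 / (e1 * e3 ^+ 5) = 3 * b - 2 * b ^+ 2.
Proof.
move=> cq [c1 c2 c3] [c4 c6 c12].
move=> /(congr1 frac) L1 /(congr1 frac) L2 /(congr1 frac) L3 /(congr1 frac) L4.
rewrite !fracE ?fe1' ?fe3' in L1 L2 L3 L4.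
have fq0 : frac q != 0 by rewrite -(rmorph0 frac) (inj_eq frac_inj).
have := level12 fq0 nz1 nz2 nz3 nz4 nz6 nz12 L1 L2 L3 L4.
have cE := (@rmorphXn _ _ c, @rmorphM _ _ c, @rmorphD _ _ c, @rmorphN _ _ c, @rmorph_nat _ _ c).
case=> [bad|bad|[h1 h2]].
- suff /(congr1 c) : (e3 ^+ 3 * e4 * (e3 ^+ 3 * e12 ^+ 6 * e2 ^+ 3) * (e2 ^+ 2 * e12 ^+ 4) -
    e6 ^+ 9 * e1 * e4 ^+ 2 * (e1 * e12 ^+ 3) * (e2 ^+ 2 * e12 ^+ 4) +
    q * (e1 * e12 ^+ 3) * (e3 ^+ 3 * e12 ^+ 6 * e2 ^+ 3) * (e2 ^+ 2 * e12 ^+ 4)) ^+ 2 +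
    3 * (e4 ^+ 4 * e6 ^+ 2 * (e1 * e12 ^+ 3) * (e3 ^+ 3 * e12 ^+ 6 * e2 ^+ 3)) ^+ 2 = 0.
    by rewrite !cE c1 c2 c3 c4 c6 c12 cq rmorph0 !expr1n !mulr1 ?mul0r.
  by apply: frac_inj; rewrite rmorph0 !fracE.
- suff /(congr1 c) : e3 ^+ 3 * e4 * (e2 ^+ 2 * e12 ^+ 4) =
    q * (e1 * e12 ^+ 3) * (e2 ^+ 2 * e12 ^+ 4) - e4 ^+ 4 * e6 ^+ 2 * (e1 * e12 ^+ 3).
    by rewrite !cE c1 c2 c3 c4 c6 c12 cq !expr1n !mulr1 ?mul0r.
  by apply: frac_inj; rewrite !fracE.
- by split; apply: frac_inj; rewrite !fracE ?(unitrM, unitrX, unitrV, units).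
Qed.
End Transfer.

(** * The 2-dissection of xi and kappa *)

Lemma spow_fps (f : series) k : spow f k = coef (FPS f ^+ k).
Proof. by elim: k => [|k IH] //; rewrite exprS /spow iterS -/(spow _ k) IH. Qed.

Lemma FPS_spow (f : series) k : FPS (spow f k) = FPS f ^+ k.
Proof. by rewrite spow_fps; case: (_ ^+ k). Qed.

Lemma FPS_smul (f g : series) : FPS (smul f g) = FPS f * FPS g.
Proof. by []. Qed.

Lemma FPS_sdil a (f : series) : FPS (sdil a f) = dil a (FPS f).
Proof. by []. Qed.

Lemma FPS_sinv (f : series) : c0 (FPS f) = 1 -> FPS (sinv f) = (FPS f)^-1.
Proof.
move=> f1; have u := c0_unitr f1; apply: (mulrI u).
by rewrite (c0_unit f1) divrr.
Qed.

Lemma c0_EX a n : (0 < a)%N -> c0 (E a ^+ n) = 1.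
Proof. by move=> a0; rewrite rmorphXn /= c0_E // expr1n. Qed.

Lemma xiE : FPS xi = E 2 ^+ 5 * E 6 / (E 1 * E 3 ^+ 5).
Proof.
rewrite /xi 2!FPS_smul FPS_spow FPS_sinv FPS_smul FPS_spow !Ea_W //.
by rewrite rmorphM /= c0_EX // c0_E.
Qed.

Lemma gammaE : FPS gamma = E 1 ^+ 5 * E 2 ^+ 5 * (E 6 ^+ 5 / E 3 ^+ 15).
Proof.
rewrite /gamma 2!FPS_smul 2!FPS_spow FPS_smul FPS_spow FPS_sinv FPS_spow !Ea_W //.
by rewrite c0_EX.
Qed.

Definition lam : fps := E 2 * E 3 ^+ 3 * E 4 ^+ 2 * E 12 ^+ 2 / (E 1 * E 6 ^+ 7).

Lemma E_unit a : (0 < a)%N -> E a \is a GRing.unit.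
Proof. by move=> a0; apply: c0_unitr; apply: c0_E. Qed.

Lemma tofrac_inj : injective (@FracField.tofrac fps).
Proof. by move=> f g /eqP; rewrite tofrac_eq => /eqP. Qed.

(* Unification must not unfold the products when comparing [E a] with [E b]. *)
Local Opaque E.

Lemma kappaE : FPS kappa = lam ^+ 5.
Proof.
rewrite /kappa FPS_smul FPS_spow FPS_sdil FPS_sinv gammaE.
  rewrite 3!rmorphM /= rmorphV ?unitrX ?E_unit // !rmorphXn /= !dil_E //.
  by apply: (eta_kappa_unit tofrac_inj); apply: E_unit.
rewrite 3!rmorphM /= rmorphV ?unitrX ?E_unit //= !c0_EX //.
Qed.

Lemma conj_lam : conj lam = E 1 * E 4 ^+ 3 * E 6 ^+ 2 / (E 2 ^+ 2 * E 3 ^+ 3 * E 12).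
Proof.
have u1 : conj (E 1) \is a GRing.unit by apply: c0_unitr; rewrite c0_conj c0_E.
have e2 := @conj_E_even 1 isT; have e4 := @conj_E_even 2 isT.
have e6 := @conj_E_even 3 isT; have e12 := @conj_E_even 6 isT; rewrite /muln /= in e2 e4 e6 e12.
rewrite /lam rmorphM /= rmorphV ?unitrM ?unitrX ?E_unit //=.
rewrite !(rmorphXn, rmorphM) /= e2 e4 e6 e12.
by apply: (eta_conj_unit tofrac_inj _ _ _ _ _ _ conj_E1 conj_E3); apply: E_unit.
Qed.

Lemma dil2_xi : dil 2 (FPS xi) = E 4 ^+ 5 * E 12 / (E 2 * E 6 ^+ 5).
Proof.
rewrite xiE rmorphM /= rmorphV ?unitrM ?unitrX ?E_unit //.
by rewrite !(rmorphXn, rmorphM) /= !dil_E.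
Qed.

Lemma lam_mul_conj : lam * conj lam = dil 2 (FPS xi).
Proof.
by rewrite conj_lam dil2_xi; apply: (eta_mul_conj_unit tofrac_inj); apply: E_unit.
Qed.

Lemma rmorph_level6_xi (R S : comNzRingType) (f : {rmorphism R -> S}) (t e1 e2 e3 e6 : R) :
    e2 ^+ 8 * e3 ^+ 4 * e6 = e1 * e2 ^+ 3 * e3 ^+ 9 + t * e1 ^+ 4 * e6 ^+ 9 ->
  f e2 ^+ 8 * f e3 ^+ 4 * f e6 = f e1 * f e2 ^+ 3 * f e3 ^+ 9 + f t * f e1 ^+ 4 * f e6 ^+ 9.
Proof. by move/(congr1 f); rewrite !(rmorphXn, rmorphD, rmorphM). Qed.

Lemma rmorph_level6_phi (R S : comNzRingType) (f : {rmorphism R -> S}) (t e1 e2 e3 e6 : R) :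
    e1 ^+ 8 * e3 * e6 ^+ 4 = e2 ^+ 4 * e3 ^+ 9 - 8 * t * e1 ^+ 3 * e2 * e6 ^+ 9 ->
  f e1 ^+ 8 * f e3 * f e6 ^+ 4 = f e2 ^+ 4 * f e3 ^+ 9 - 8 * f t * f e1 ^+ 3 * f e2 * f e6 ^+ 9.
Proof. by move/(congr1 f); rewrite !(rmorphXn, rmorphB, rmorphM, rmorph_nat). Qed.

Lemma level6_conj : E 2 ^+ 8 * conj (E 3) ^+ 4 * E 6 =
  conj (E 1) * E 2 ^+ 3 * conj (E 3) ^+ 9 + (- q) * conj (E 1) ^+ 4 * E 6 ^+ 9.
Proof.
have e2 := @conj_E_even 1 isT; have e6 := @conj_E_even 3 isT; rewrite /muln /= in e2 e6.
by have := rmorph_level6_xi conj level6_xi; rewrite /= conj_q e2 e6.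
Qed.

Lemma dil2_q : dil 2 q = q ^+ 2.
Proof. by rewrite -[q in LHS]expr1 dil_qn. Qed.

Lemma level6_dil2 : E 4 ^+ 8 * E 6 ^+ 4 * E 12 = E 2 * E 4 ^+ 3 * E 6 ^+ 9 + q ^+ 2 * E 2 ^+ 4 * E 12 ^+ 9.
Proof. by have := rmorph_level6_xi (dil 2) level6_xi; rewrite /= dil2_q !dil_E. Qed.

Lemma level6_phi_dil2 :
  E 2 ^+ 8 * E 6 * E 12 ^+ 4 = E 4 ^+ 4 * E 6 ^+ 9 - 8 * q ^+ 2 * E 2 ^+ 3 * E 4 * E 12 ^+ 9.
Proof. by have := rmorph_level6_phi (dil 2) level6_phi; rewrite /= dil2_q !dil_E. Qed.

Lemma lam_relations : lam + conj lam = 2 * dil 2 (FPS xi) /\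
  FPS xi = 3 * conj lam - 2 * conj lam ^+ 2.
Proof.
rewrite conj_lam dil2_xi xiE.
apply: (level12_unit tofrac_inj q_neq0 _ _ _ _ _ _ conj_E1 conj_E3 c0_q _ _
  level6_xi level6_conj level6_dil2 level6_phi_dil2); try exact: E_unit.
  by split; apply: c0_E.
by split; apply: c0_E.
Qed.

(** * The polynomials and their 2-adic valuations *)

(* If a + b = 2 x and a b = x then a ^ (2 h) + b ^ (2 h) = 2 x ^ h e_h(x) and
   a ^ (2 h + 1) + b ^ (2 h + 1) = 2 x ^ (h + 1) o_h(x), where cheb h = (e_h, o_h). *)
Fixpoint cheb h : {poly int} * {poly int} :=
  if h is h'.+1 then
    let e := ('X * (cheb h').2) *+ 2 - (cheb h').1 in (e, e *+ 2 - (cheb h').2)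
  else (1, 1).

Lemma cheb_coef1 h s :
  ((cheb h.+1).1)`_s = (if s is s'.+1 then ((cheb h).2)`_s' *+ 2 else 0) - ((cheb h).1)`_s.
Proof. by rewrite /= coefB coefMn coefXM; case: s => //=; rewrite mul0rn. Qed.

Lemma cheb_coef2 h s : ((cheb h.+1).2)`_s = ((cheb h.+1).1)`_s *+ 2 - ((cheb h).2)`_s.
Proof. by rewrite [in LHS]/= coefB coefMn. Qed.

(** One step from o to e multiplies by 2x, and one from e to o by 2, so raising the degree by one
    costs two factors 2. At s = 0 the truncated predecessor makes the first claim void. *)
Lemma cheb_dvd h s :
  (2 ^+ (s.*2).-1 %| ((cheb h).1)`_s)%Z && (2 ^+ s.*2 %| ((cheb h).2)`_s)%Z.
Proof.
elim: h s => [|h IH] s.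
  by rewrite coef1; case: s => [|s]; rewrite ?dvd1z ?dvdz0.
have dvd1 : (2 ^+ (s.*2).-1 %| ((cheb h.+1).1)`_s)%Z.
  rewrite cheb_coef1 rpredB //; last by have /andP[] := IH s.
  case: s => [|s]; first exact: dvdz0.
  by rewrite doubleS /= exprSr -(mulr_natr (_`_s) 2) dvdz_mul //; have /andP[] := IH s.
rewrite dvd1 cheb_coef2 rpredB //; last by have /andP[] := IH s.
case: s dvd1 => [|s] dvd1; first by rewrite dvd1z.
by rewrite doubleS -(mulr_natr (_`_s.+1) 2) exprSr dvdz_mul.
Qed.

Lemma cheb_odd h : ~~ (2 %| ((cheb h).1)`_0)%Z && ~~ (2 %| ((cheb h).2)`_0)%Z.
Proof.
elim: h => [|h /andP[o1 o2]]; first by rewrite coef1.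
have o1' : ~~ (2 %| ((cheb h.+1).1)`_0)%Z by rewrite cheb_coef1 sub0r rpredN.
by rewrite o1' cheb_coef2; move: (_`_0) (_`_0) o2 => u v; lia.
Qed.

(** The constant term of o_h is odd, so modulo 4 the recurrence reads v -> 2 - v, and the values
    alternate between 0 and 2. *)
Lemma cheb_coef1_mod4 h : (4 %| ((cheb h).1)`_1 - (h.*2)%:Z)%Z.
Proof.
elim: h => [|h IH]; first by rewrite coef1.
have /andP[_ o2] := cheb_odd h.
rewrite cheb_coef1; move: (_`_0) (_`_1) IH o2 => u v; lia.
Qed.

(** * Symmetric expressions in the two roots as polynomials in x *)

Section Eval.
Variables (R : comNzRingType) (x a b : R).
Hypotheses (ab_sum : a + b = 2 * x) (ab_prod : a * b = x).

Definition ev (P : {poly int}) : R := (map_poly intr P).[x].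

Fact ev_zmod : zmod_morphism ev.
Proof. by move=> P Q; rewrite /ev rmorphB hornerD hornerN. Qed.
Fact ev_mul : monoid_morphism ev.
Proof. by split=> [|P Q]; rewrite /ev ?rmorph1 ?hornerC // rmorphM hornerM. Qed.
HB.instance Definition _ := GRing.isZmodMorphism.Build _ _ ev ev_zmod.
HB.instance Definition _ := GRing.isMonoidMorphism.Build _ _ ev ev_mul.

Lemma evX : ev 'X = x. Proof. by rewrite /ev map_polyX hornerX. Qed.

Lemma evZ (c : int) (P : {poly int}) : ev (c *: P) = c%:~R * ev P.
Proof. by rewrite -mul_polyC rmorphM /= {1}/ev map_polyC hornerC. Qed.

Lemma cheb_ev h :
  a ^+ h.*2 + b ^+ h.*2 = 2 * (x ^+ h * ev (cheb h).1) /\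
  a ^+ h.*2.+1 + b ^+ h.*2.+1 = 2 * (x ^+ h.+1 * ev (cheb h).2).
Proof.
have rec n : a ^+ n.+2 + b ^+ n.+2 = (a + b) * (a ^+ n.+1 + b ^+ n.+1) - a * b * (a ^+ n + b ^+ n).
  by rewrite !exprS; ring.
elim: h => [|h [IH1 IH2]].
  by rewrite double0 !expr0 !expr1 /= rmorph1 !mulr1 -ab_sum.
have e1 : a ^+ h.+1.*2 + b ^+ h.+1.*2 = 2 * (x ^+ h.+1 * ev (cheb h.+1).1).
  rewrite doubleS rec IH1 IH2 ab_sum ab_prod [ev _ in RHS]rmorphB rmorphMn rmorphM /= evX exprS.
  by rewrite -mulr_natr; ring.
split=> //; rewrite doubleS rec -doubleS e1 IH2 ab_sum ab_prod.
rewrite [ev (cheb h.+1).2]rmorphB rmorphMn /= !exprS -mulr_natr; ring.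
Qed.

(** Half of a^A b^m + b^A a^m as a polynomial in x: the power min(A, m) of ab = x factors out,
    leaving a power sum of order n = |A - m|, written with truncated subtractions. *)
Definition cross A m : {poly int} :=
  let n := (A - m + (m - A))%N in
  if odd n then 'X^(minn A m + n./2.+1) * (cheb n./2).2 else 'X^(minn A m + n./2) * (cheb n./2).1.

Lemma cross_ev A m : a ^+ A * b ^+ m + b ^+ A * a ^+ m = 2 * ev (cross A m).
Proof.
have pow n : a ^+ n + b ^+ n =
    2 * ev (if odd n then 'X^(n./2.+1) * (cheb n./2).2 else 'X^(n./2) * (cheb n./2).1).
  have [h1 h2] := cheb_ev n./2; rewrite -{1 2}(odd_double_half n).
  by case: odd; rewrite rmorphM rmorphXn /= evX ?add1n ?add0n.
have -> : ev (cross A m) = x ^+ minn A m *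
    ev (let n := (A - m + (m - A))%N in
      if odd n then 'X^(n./2.+1) * (cheb n./2).2 else 'X^(n./2) * (cheb n./2).1).
  by rewrite /cross /=; case: odd; rewrite !rmorphM !rmorphXn /= evX exprD mulrA.
rewrite mulrCA -pow -ab_prod.
case: (leqP A m) => [le_Am|/ltnW le_mA].
  rewrite (_ : A - m = 0)%N ?add0n; last by apply/eqP.
  by rewrite -{1 2}(subnKC le_Am) !exprD exprMn; ring.
rewrite (_ : m - A = 0)%N ?addn0; last by apply/eqP.
by rewrite -{1 2}(subnKC le_mA) !exprD exprMn; ring.
Qed.

(** Obtained from (3b - 2b^2)^j = b^j (3 - 2b)^j by the binomial theorem; for A = 5i it represents
    zeta_{i,j}. *)
Definition zpoly A j : {poly int} :=
  \sum_(r < j.+1) ('C(j, r)%:Z * 3 ^+ (j - r) * (- 2) ^+ r) *: cross A (j + r).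

Lemma zpoly_ev A j :
  a ^+ A * (3 * b - 2 * b ^+ 2) ^+ j + b ^+ A * (3 * a - 2 * a ^+ 2) ^+ j = 2 * ev (zpoly A j).
Proof.
have expand (t : R) : (3 * t - 2 * t ^+ 2) ^+ j =
    \sum_(r < j.+1) ('C(j, r)%:Z * 3 ^+ (j - r) * (- 2) ^+ r)%:~R * t ^+ (j + r).
  have -> : 3 * t - 2 * t ^+ 2 = t * (3 + (- 2) * t) by ring.
  rewrite exprMn exprDn big_distrr; apply: eq_bigr => r _ /=.
  rewrite -mulr_natl exprMn exprD !rmorphM !rmorphXn /= rmorphN /=; ring.
rewrite !expand !big_distrr -big_split /= /zpoly rmorph_sum big_distrr /=; apply: eq_bigr => r _.
by rewrite evZ [RHS]mulrCA -cross_ev; ring.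
Qed.
End Eval.

(** For A even, the lowest exponent is A/2 + ceil(m/2) whichever of A and m is larger. *)
Lemma cross_coef A m t : ~~ odd A ->
  (cross A m)`_t = if odd m then
      if (A./2 + uphalf m <= t)%N then ((cheb ((A - m + (m - A))./2)).2)`_(t - (A./2 + uphalf m)) else 0
    else if (A./2 + uphalf m <= t)%N then ((cheb ((A - m + (m - A))./2)).1)`_(t - (A./2 + uphalf m)) else 0.
Proof.
move=> evA; rewrite /cross.
have -> : odd (A - m + (m - A)) = odd m by lia.
case: ifP => om; rewrite coefXnM ltnNge.
  have -> : (minn A m + ((A - m + (m - A))./2).+1 = A./2 + uphalf m)%N by lia.
  by case: leq.
have -> : (minn A m + (A - m + (m - A))./2 = A./2 + uphalf m)%N by lia.
by case: leq.
Qed.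

(** * Divisibility of the coefficients by powers of 2 *)

Section Valuation.
Variables (A j : nat).
Hypotheses (evenA : ~~ odd A).

Let w r : int := 'C(j, r)%:Z * 3 ^+ (j - r) * (- 2) ^+ r.
Let d := (A./2 + uphalf j)%N.

Let w_dvd r : (2 ^+ r %| w r)%Z.
Proof. by rewrite /w exprNn mulrA dvdz_mull // dvdz_mull. Qed.

Let zpoly_coef t : (zpoly A j)`_t = \sum_(r < j.+1) w r * (cross A (j + r))`_t.
Proof. by rewrite /zpoly coef_sum; apply: eq_bigr => r _; rewrite coefZ. Qed.

Let dvd_pow n m (z : int) : (n <= m)%N -> (2 ^+ m %| z)%Z -> (2 ^+ n %| z)%Z.
Proof. by move=> le_nm; apply: dvdz_trans; apply: dvdz_exp2l. Qed.

Let dvd_term n r s (z : int) : (2 ^+ s %| z)%Z -> (n <= r + s)%N -> (2 ^+ n %| w r * z)%Z.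
Proof. by move=> dz le_n; apply: (dvd_pow le_n); rewrite exprD dvdz_mul. Qed.

(** There are r factors 2 from [w r] and 2s or 2s - 1 from [cheb_dvd]. The lowest exponent of term r
    lies about r/2 above d, so s is about M - r/2; by parity the total is at least 2M - 1, which is
    at least M + 1 for M >= 2. For M = 1 and r >= 2, already 4 divides [w r]. *)
Lemma zpoly_term_dvd r M : (1 < M)%N || (1 < r)%N && (0 < M)%N ->
  (2 ^+ M.+1 %| w r * (cross A (j + r))`_(d + M))%Z.
Proof.
move=> hM; rewrite cross_coef //; set s := (d + M - _)%N; set h := (_ + _)./2.
have /andP[e o] := cheb_dvd h s.
case: ifP => om; (case: leqP => [le|]; last by rewrite mulr0 dvdz0).
  by apply: dvd_term o _; move: le om hM; rewrite /s /d; lia.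
by apply: dvd_term e _; move: le om hM; rewrite /s /d; lia.
Qed.

Let w0_odd : ~~ (2 %| w 0)%Z.
Proof.
rewrite /w bin0 mulr1 mul1r subn0; elim: j => // n.
by rewrite exprS; move: (3 ^+ n) => v; lia.
Qed.

(** Modulo 2 only r = 0 survives, with an odd weight 3^j and an odd lowest coefficient. *)
Lemma zpoly_lead_odd : ~~ (2 %| (zpoly A j)`_d)%Z.
Proof.
rewrite zpoly_coef big_ord_recl /= addn0 cross_coef // leqnn subnn.
set c := (if _ then _ else _); set S := (X in _ + X).
have dS : (2 %| S)%Z.
  by rewrite rpred_sum // => r _; rewrite dvdz_mulr // -[2]expr1 (dvd_pow _ (w_dvd _)).
have oddc : ~~ (2 %| c)%Z by have /andP[] := cheb_odd (A - j + (j - A))./2; rewrite /c; case: odd.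
move: c S (w 0) dS oddc w0_odd => c S v; clear; nia.
Qed.

Let zpoly_next_mod4 :
  (4 %| (zpoly A j)`_(d + 1) - w 0 * (cross A j)`_(d + 1))%Z.
Proof.
rewrite zpoly_coef big_ord_recl /= addn0 addrC addKr rpred_sum // => -[r lt_r] _.
rewrite /bump leq0n add1n /=; case: r lt_r => [|r] _; last exact: (@zpoly_term_dvd r.+2 1).
(* Only r = 1 is left: for j even its weight -2 j 3^(j-1) is divisible by 4; for j odd the weight
   and the coefficient are both even. *)
have [oj|ej] := boolP (odd j); last first.
  have [l jl] : exists l, j = l.*2 by exists j./2; rewrite even_halfK.
  by rewrite /w bin1 dvdz_mulr // {1}jl -muln2; move: (3 ^+ _) => v; lia.
rewrite cross_coef // addn1 /= oj /= /d.
have -> : (A./2 + uphalf j + 1 - (A./2 + uphalf j.+1) = 1)%N by lia.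
case: ifP => _; last by rewrite mulr0 dvdz0.
set h := (_ + _)./2; have /andP[e _] := cheb_dvd h 1.
exact: dvdz_mul (w_dvd 1) e.
Qed.

(** Modulo 4 only r = 0 matters. For j odd its coefficient is one of o_h, divisible by 4; for 4
    dividing j, h = |A - j|/2 is even and the coefficient is congruent to 2h. *)
Lemma zpoly_next_dvd : (j %% 4 != 2)%N -> (4 %| A)%N -> (4 %| (zpoly A j)`_(d + 1))%Z.
Proof.
move=> j4 A4; rewrite -(subrK (w 0 * (cross A j)`_(d + 1)) (zpoly A j)`_(d + 1)) rpredD //.
rewrite dvdz_mull // cross_coef // /d leq_addr addKn.
set h := (_ + _)./2; have /andP[_ o] := cheb_dvd h 1.
case: ifP => // ej; have := cheb_coef1_mod4 h; have : ~~ odd h by rewrite /h; lia.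
by move: (_`_1) => v; lia.
Qed.

(** Now h = |A - j|/2 is odd, so the r = 0 coefficient is congruent to 2 modulo 4 and its weight is
    odd. *)
Lemma zpoly_next_ndvd : (j %% 4 == 2)%N -> (4 %| A)%N ->
  (2 %| (zpoly A j)`_(d + 1))%Z && ~~ (4 %| (zpoly A j)`_(d + 1))%Z.
Proof.
move=> j4 A4; have := zpoly_next_mod4; rewrite cross_coef // /d leq_addr addKn.
set h := (_ + _)./2; have oh : odd h by rewrite /h; lia.
rewrite ifF; last by lia.
have := cheb_coef1_mod4 h; move: (_`_1) (_`_(_ + _ + 1)) (w 0) w0_odd => u z v v_odd u2.
have [l u_l] : exists l, u = 4 * l + 2 by exists ((u - 2) %/ 4)%Z; lia.
have -> : v * u = 4 * (v * l) + 2 * v by rewrite u_l; ring.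
by move: (v * l) v_odd => n; lia.
Qed.

Lemma zpoly_tail_dvd M : (1 < M)%N -> (2 ^+ M.+1 %| (zpoly A j)`_(d + M))%Z.
Proof.
by move=> M1; rewrite zpoly_coef rpred_sum // => r _; rewrite zpoly_term_dvd // M1.
Qed.
End Valuation.

Lemma pevalE P (f : fps) n : peval P (coef f) n = coef (ev f P) n.
Proof.
rewrite /ev (@horner_coef_wide _ (size P)); last exact: size_poly.
rewrite -[RHS]/(coefn n _) raddf_sum /peval; apply: eq_bigr => i _.
rewrite coef_map mulrzl raddfMz /coefn spow_fps -mulrzr.
by rewrite mulrC intz; case: f.
Qed.

Lemma ev_dil a (f : fps) P : (0 < a)%N -> ev (dil a f) P = dil a (ev f P).
Proof.
case: a => // a _; rewrite /ev -horner_map /= -map_poly_comp; congr (_.[_]).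
by apply: eq_map_poly => z /=; rewrite rmorph_int.
Qed.

Lemma zeta_peval i j n : zeta i j n = peval (zpoly (5 * i) j) xi n.
Proof.
have [hsum hxi] := lam_relations; have hprod := lam_mul_conj.
have conj_quad y : conj (3 * y - 2 * y ^+ 2) = 3 * conj y - 2 * conj y ^+ 2.
  by rewrite rmorphB !(rmorphXn, rmorphM, rmorph_nat).
set F := FPS kappa ^+ i * FPS xi ^+ j.
have -> : zeta i j n = coef (FPS (U2 (coef F))) n.
  by rewrite /= /zeta /U2 /F !spow_fps.
have -> : peval (zpoly (5 * i) j) xi n = coef (ev (FPS xi) (zpoly (5 * i) j)) n.
  by rewrite -pevalE.
(* The series are compared after q -> q^2 and doubling, where [add_conj] and [zpoly_ev] apply with a
   = lambda and b = lambda(-q). *)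
congr coef; apply: (@dil_inj 2) => //; apply: fps_mulrn2_inj.
rewrite -add_conj -ev_dil // -mulr_natl -(zpoly_ev hsum hprod).
rewrite /F rmorphM !rmorphXn /= kappaE rmorphXn /= -!exprM hxi.
by rewrite conj_quad conjK.
Qed.

Lemma nu_geP z n : (2 ^+ n %| z)%Z -> nu_ge z n.
Proof.
rewrite /nu_ge dvdzE abszX; case: eqVneq => //= z0.
by rewrite pfactor_dvdn // absz_gt0.
Qed.

Lemma nu_eqP z n : (2 ^+ n %| z)%Z -> ~~ (2 ^+ n.+1 %| z)%Z -> nu_eq z n.
Proof.
rewrite /nu_eq !dvdzE !abszX; case: eqVneq => [->|z0] //=; first by rewrite !dvdn0.
by rewrite !pfactor_dvdn ?absz_gt0 // -leqNgt eqn_leq => -> ->.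
Qed.

(* zeta_{2^k,j} = sum_m Z(m) xi^m with Z(m) = P`_m for the (unique) integer
   polynomial P with zeta_{2^k,j} = P(xi). *)
Theorem theorem4p4 (k j : nat) : (2 <= k)%N ->
  exists P : {poly int},
    (forall n, zeta (2 ^ k) j n = peval P xi n) /\
    nu_eq P`_(dd (2 ^ k) j) 0 /\
    (if (j %% 4 == 2)%N then nu_eq P`_(dd (2 ^ k) j + 1) 1
     else nu_ge P`_(dd (2 ^ k) j + 1) 2) /\
    (forall M : nat, (2 <= M)%N -> nu_ge P`_(dd (2 ^ k) j + M) (M + 1)).
Proof.
case: k => [|[|k]] // _; exists (zpoly (5 * 2 ^ k.+2) j); split=> [n|]; first exact: zeta_peval.
(* Here k >= 2 enters: A/2 is even, so for j even |A - j|/2 has the parity of j/2. *)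
have A4 : (4 %| 5 * 2 ^ k.+2)%N by rewrite !expnS dvdn_mull // mulnA dvdn_mulr.
have evA : ~~ odd (5 * 2 ^ k.+2) by lia.
(* For even i both branches of [dd] equal A/2 + ceil(j/2) with A = 5i, the lowest exponent of
   [zpoly]. *)
have -> : dd (2 ^ k.+2) j = ((5 * 2 ^ k.+2)./2 + uphalf j)%N.
  have ev2 : ~~ odd (2 ^ k.+2) by rewrite oddX.
  by rewrite /dd ev2; move: (2 ^ k.+2)%N ev2 => m; case: ifP; lia.
split; last split; last by move=> M M1; rewrite addn1 nu_geP // zpoly_tail_dvd.
  by apply: nu_eqP; rewrite ?dvd1z // expr1 zpoly_lead_odd.
case: ifP => [j2|/negbT j2]; last by apply: nu_geP; apply: zpoly_next_dvd.
by have /andP[dvd2 ndvd4] := zpoly_next_ndvd evA j2 A4; apply: nu_eqP; [exact: dvd2|exact: ndvd4].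
Qed.
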